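(* Let $F\in C^3(\mathbb R^m,\mathbb R)$ be nonnegative, vanishing exactly on $\{\bm z_1,\dots,\bm z_K\}$ ($K\ge2$), with positive definite Hessian at each $\bm z_j$. Let $\bm v:[a,b]\to\{\bm z_1,\dots,\bm z_K\}$ be a step function having exactly $N$ jumps, located at $a<\gamma_1<\dots<\gamma_N<b$. For $\varepsilon>0$ (small), let $\bm u_0^\varepsilon:[a,b]\to\mathbb R^m$ be the function equal to $\bm v$ outside $\bigcup_{i=1}^N(\gamma_i-r,\gamma_i+r)$ and given, in each $(\gamma_i-r,\gamma_i+r)$, by $$\bm u_0^\varepsilon(x)=\begin{cases}\bm v_i^-+\dfrac{x-\gamma_i+r}{\varepsilon}\big(\bm\psi_i(w_i(1-r/\varepsilon))-\bm v_i^-\big), & x\in(\gamma_i-r,\gamma_i-r+\varepsilon),\\[2mm] \bm\psi_i\big(w_i((x-\gamma_i)/\varepsilon)\big), & x\in[\gamma_i-r+\varepsilon,\gamma_i+r-\varepsilon],\\[2mm] \bm v_i^++\dfrac{\gamma_i+r-x}{\varepsilon}\big(\bm\psi_i(w_i(r/\varepsilon-1))-\bm v_i^+\big), & x\in(\gamma_i+r-\varepsilon,\gamma_i+r),\end{cases}$$ where $\bm v_i^\pm$, the optimal paths $\bm\psi_i$ and the profiles $w_i$ are as defined in the context. Then, for all $A\in\big(0,c\,\sigma^{-1}r\sqrt{2\lambda}\big)$ (where $c>0$ is the constant in the linear lower bounds for the paths $\bm\psi_i$ given in the context and $\sigma=\max_i\sigma_i$), there exist constants $\varepsilon_0,C>0$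 such that, if $\varepsilon\in(0,\varepsilon_0)$, then $$P_\varepsilon[\bm u_0^\varepsilon]\le P_0[\bm v]+C\exp(-A/\varepsilon).$$
   Context: Here $m\ge1$ and $[a,b]$ is a bounded interval. The number $r>0$ is fixed so small that $(\gamma_i-r,\gamma_i+r)\subset[a,b]$ for all $i$ and these intervals are pairwise disjoint. The number $\lambda>0$ is the minimum over $j=1,\dots,K$ of the smallest eigenvalue of $\nabla^2F(\bm z_j)$. Energies: for (piecewise $C^1$ or) $H^1$ functions $\bm u$, $$P_\varepsilon[\bm u]=\int_a^b\Big[\tfrac\varepsilon2|\bm u_x|^2+\tfrac{F(\bm u)}\varepsilon\Big]dx.$$ For absolutely continuous $\bm z:[a,b]\to\mathbb R^m$ let $J[\bm z]=\sqrt2\int_a^b\sqrt{F(\bm z(s))}\,|\bm z'(s)|\,ds$, let $$\phi(\bm\xi_1,\bm\xi_2)=\inf\{J[\bm z]:\bm z\in AC([a,b],\mathbb R^m),\ \bm z(a)=\bm\xi_1,\ \bm z(b)=\bm\xi_2\},$$ and $P_0[\bm v]=\sum_{i=1}^N\phi(\bm v(\gamma_i-r),\bm v(\gamma_i+r))$. Notation: $\bm v_i^\pm:=\bm v(\gamma_i\pm r)$. Optimal paths: for each $i$, $\bm\psi_i:[a,b]\to\mathbb R^m$ is a Lipschitz continuous path from $\bm\psi_i(a)=\bm v_i^-$ to $\bm\psi_i(b)=\bm v_i^+$, parametrized by a multiple of Euclidean arclength so that $|\bm\psi_i'|=\sigma_i$ almost everywhere with $\sigma_i>0$ constant, with $\phi(\bm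 v_i^-,\bm v_i^+)=J[\bm\psi_i]$, not passing through any zero of $F$ except at its endpoints, and such that (with a constant $c>0$ common to all $i$) $|\bm\psi_i(w)-\bm v_i^-|\ge c(w-a)$ for $w$ near $a$ and $|\bm\psi_i(w)-\bm v_i^+|\ge c(b-w)$ for $w$ near $b$. (The existence of such paths is a known result that is taken for granted.) Profiles: $w_i:\mathbb R\to(a,b)$ is the unique $C^1$ solution of $w'=\sigma_i^{-1}\sqrt{2F(\bm\psi_i(w))}$, $w(0)=\frac{a+b}2$; it satisfies $w_i(x)\to a$ as $x\to-\infty$ and $w_i(x)\to b$ as $x\to+\infty$. *)

(* Defs.v *)
(* MathComp-Analysis world; the real line is an arbitrary [R : realType]. *)
From mathcomp Require Import all_boot all_order all_algebra.
From mathcomp Require Import all_classical all_reals all_analysis.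

Set Implicit Arguments.
Unset Strict Implicit.
Unset Printing Implicit Defensive.

Import Order.TTheory GRing.Theory Num.Theory numFieldNormedType.Exports.

Local Open Scope classical_set_scope.
Local Open Scope ring_scope.

Section Calculus.
Context {R : realType} {m : nat}.
Implicit Types (F : 'rV[R]_m -> R) (x : 'rV[R]_m).

(* The library norm `|x| on 'rV[R]_m is the sup norm. *)
Definition enorm x : R := Num.sqrt (\sum_(i < m) x ord0 i ^+ 2).

(* All partial derivatives of order at most k exist and are continuous. *)
Fixpoint Ck (k : nat) F : Prop :=
  continuous F /\
  if k is k'.+1 then
    forall i : 'I_m, (forall x, derivable F x (delta_mx ord0 i)) /\
                     Ck k' ('D_(delta_mx ord0 i) F)
  else True.

Definition hessian F x : 'M[R]_m :=
  \matrix_(i < m, j < m) 'D_(delta_mx ord0 i) ('D_(delta_mx ord0 j) F) x.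

Definition posdef (H : 'M[R]_m) : Prop :=
  H^T = H /\ forall x, x != 0 -> 0 < (x *m H *m x^T) ord0 ord0.

End Calculus.

Definition minimum_of {R : realType} (A : set R) (l : R) : Prop :=
  A l /\ lbound A l.

Definition smallest_eigenvalue {R : realType} {m : nat} (H : 'M[R]_m) (l : R) :
    Prop :=
  minimum_of [set t | eigenvalue H t] l.

Section Functionals.
Context {R : realType} {m : nat}.
Variables (F : 'rV[R]_m -> R) (a b : R).
Implicit Types (u z psi v : R -> 'rV[R]_m).

Definition abs_continuous z : Prop :=
  forall e : R, 0 < e -> exists2 d : R, 0 < d &
    forall (n : nat) (s t : 'I_n -> R),
      (forall k, [/\ a <= s k, s k <= t k & t k <= b]) ->
      trivIset setT (fun k => [set` `]s k, t k[ ]) ->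
      \sum_(k < n) (t k - s k) < d ->
      \sum_(k < n) enorm (z (t k) - z (s k)) < e.

(* Functions on [a, b] are represented by total functions on R, and their almost
   everywhere derivative by [derive1], which takes a default value at the points
   where the derivative does not exist. The integrands are nonnegative when F
   is, so that the integrals make sense in [0, +oo]. *)
Definition P_ (eps : R) u : \bar R :=
  (\int[lebesgue_measure]_(x in `[a, b])
     (eps / 2 * enorm (derive1 u x) ^+ 2 + F (u x) / eps)%:E)%E.

Definition J z : \bar R :=
  ((Num.sqrt 2)%:E *
   \int[lebesgue_measure]_(s in `[a, b])
     (Num.sqrt (F (z s)) * enorm (derive1 z s))%:E)%E.

Definition phi (xi1 xi2 : 'rV[R]_m) : \bar R :=
  ereal_inf [set J z | z in [set z | [/\ abs_continuous z,
                                         z a = xi1 & z b = xi2]]].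

Definition P0 (N : nat) (gamma : 'I_N -> R) (r : R) v : \bar R :=
  (\sum_(i < N) phi (v (gamma i - r)%R) (v (gamma i + r)%R))%E.

(* c is the constant of the linear lower bounds at the two ends of the path. *)
Definition optimal_path (c : R) (xi1 xi2 : 'rV[R]_m) (sigma : R) psi : Prop :=
  [/\ [lipschitz psi s | s in [set` `[a, b] ]],
      psi a = xi1 /\ psi b = xi2,
      0 < sigma /\
        {ae (@lebesgue_measure R), forall s, s \in `]a, b[ ->
           derivable psi s 1 /\ enorm (derive1 psi s) = sigma},
      phi xi1 xi2 = J psi &
      [/\ forall s, s \in `]a, b[ -> F (psi s) <> 0,
          \forall s \near a^'+, c * (s - a) <= enorm (psi s - xi1) &
          \forall s \near b^'-, c * (b - s) <= enorm (psi s - xi2)]].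

(* The equation determines w uniquely, as well as its limits a at -oo and b at
   +oo. *)
Definition profile (sigma : R) psi (w : R -> R) : Prop :=
  [/\ forall x, w x \in `]a, b[,
      (forall x, derivable w x 1) /\ continuous (derive1 w),
      forall x, derive1 w x = sigma^-1 * Num.sqrt (2 * F (psi (w x))) &
      w 0 = (a + b) / 2].

(* The value of v at a jump point is unconstrained. *)
Definition step_with_jumps (N : nat) (gamma : 'I_N -> R) v : Prop :=
  [/\ forall i, gamma i \in `]a, b[,
      {homo gamma : i j / (i < j)%N >-> i < j},
      forall x y, a <= x -> x <= y -> y <= b ->
        (forall i, gamma i \notin `[x, y]) -> v x = v y &
      forall i, lim (v x @[x --> (gamma i)^'-]) <>
                lim (v x @[x --> (gamma i)^'+])].

(* The intervals ]gamma i - r, gamma i + r[ are pairwise disjoint whenever this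
   is used, so the index picked at x is the only possible one. *)
Definition u0 (N : nat) (gamma : 'I_N -> R) (r : R) v
    (psi : 'I_N -> R -> 'rV[R]_m) (w : 'I_N -> R -> R) (eps x : R) : 'rV[R]_m :=
  if [pick i | x \in `]gamma i - r, gamma i + r[ ] is Some i then
    let vm := v (gamma i - r) in
    let vp := v (gamma i + r) in
    if x < gamma i - r + eps then
      vm + ((x - gamma i + r) / eps) *: (psi i (w i (1 - r / eps)) - vm)
    else if x <= gamma i + r - eps then
      psi i (w i ((x - gamma i) / eps))
    else
      vp + ((gamma i + r - x) / eps) *: (psi i (w i (r / eps - 1)) - vp)
  else v x.

End Functionals.

(* Main.v *)
Require Import Defs.
From mathcomp Require Import all_boot all_order all_algebra.
From mathcomp Require Import all_classical all_reals all_analysis.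
From mathcomp Require Import measurable_realfun.
From mathcomp Require Import ring lra.

Set Implicit Arguments.
Unset Strict Implicit.
Unset Printing Implicit Defensive.

Import Order.TTheory GRing.Theory Num.Theory numFieldNormedType.Exports.

Local Open Scope classical_set_scope.
Local Open Scope ring_scope.

(* The energy density is bounded separately on each side of, and inside, the
   three parts of a transition layer. In the middle part the profile equation
   makes the two terms of the density equal (equipartition), so the substitution
   [s = w ((x - gamma) / eps)] turns the energy into a piece of the weighted
   length [J psi], which is the optimal value [phi]. On the two affine parts,
   of length [eps], the energy is at most a constant times [|q|^2], where
   [q = psi (w (1 - r / eps)) - v^-], because [F] is quadratic near its zeros.
   There [F (z + h) >= lambda / 4 |h|^2] and the linear lower bound on the path
   give [w' >= k (w - a)] with [k = c / sigma * sqrt (lambda / 2)], so [w - a]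
   decays like [exp (k x)] at [-oo]. Squaring doubles the rate, and
   [2 k r = c / sigma * r * sqrt (2 lambda)] is the announced bound on [A]. *)

(** * Integrals of nonnegative functions *)

Section nonneg_integral.
Local Open Scope ereal_scope.
Context d (T : measurableType d) (R : realType).
Variable mu : {measure set T -> \bar R}.
Implicit Types (A B D : set T) (f g : T -> \bar R).

Import HBNNSimple.

Lemma ge0_integral_leP D f M : (forall x, D x -> 0 <= f x) ->
  (forall h : {nnsfun T >-> R}, (forall x, (h x)%:E <= (f \_ D) x) ->
    \int[mu]_x (h x)%:E <= M) ->
  \int[mu]_(x in D) f x <= M.
Proof.
move=> f0 hM; rewrite ge0_integralE//; apply: ge_ereal_sup => _ /= [h hf <-].
by rewrite -integralT_nnsfun; exact: hM.
Qed.

Lemma nnsfun_le_integral D f (h : {nnsfun T >-> R}) :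
  (forall x, D x -> 0 <= f x) -> (forall x, (h x)%:E <= (f \_ D) x) ->
  \int[mu]_x (h x)%:E <= \int[mu]_(x in D) f x.
Proof.
move=> f0 hf; rewrite integralT_nnsfun ge0_integralE//.
by apply: ereal_sup_ubound => /=; exists h.
Qed.

Let EFin_nnsfun_ge0 (h : {nnsfun T >-> R}) x : 0 <= (h x)%:E.
Proof. by rewrite lee_fin; exact: fun_ge0. Qed.

Let measurable_nnsfun (h : {nnsfun T >-> R}) D :
  measurable_fun D (fun x => (h x)%:E).
Proof. by apply/measurable_EFinP; exact: measurable_funTS. Qed.

Let proj_nnsfunE (h : {nnsfun T >-> R}) A (mA : measurable A) x :
  (proj_nnsfun h mA x)%:E = ((EFin \o h) \_ A) x.
Proof.
by rewrite patchE /= mindicE; case: (_ \in _); rewrite ?(mulr1, mulr0).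
Qed.

(* The integral of a nonnegative function is a supremum over simple functions,
   so comparisons and subadditivity need no measurability of the integrand. *)
Lemma ge0_integral_ae_le D f g : measurable D ->
  (forall x, D x -> 0 <= f x) -> (forall x, D x -> 0 <= g x) ->
  {ae mu, forall x, D x -> f x <= g x} ->
  \int[mu]_(x in D) f x <= \int[mu]_(x in D) g x.
Proof.
move=> mD f0 g0 [N [mN muN fgN]]; apply: ge0_integral_leP => // h hf.
have mNC : measurable (~` N) by exact: measurableC.
(* Removing the null set [N] costs nothing, and the restriction of [h] to its complement is a simple
   function lying below [g] everywhere on [D]. *)
rewrite (ge0_negligible_integral mN) ?setTD//.
rewrite integral_mkcond.
under eq_integral do rewrite -(proj_nnsfunE h mNC).
apply: nnsfun_le_integral => // x; rewrite proj_nnsfunE !patchE.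
case: ifPn => [|_]; last by case: ifPn => //; rewrite inE => /g0.
rewrite inE => Nx; have := hf x; rewrite patchE; case: ifPn => //.
rewrite inE => Dx /le_trans; apply.
by apply: contrapT => fg; apply: Nx; apply: fgN => /= /(_ Dx).
Qed.

Lemma ge0_integral_setU_le A B f : measurable A -> measurable B ->
  (forall x, A x -> 0 <= f x) -> (forall x, B x -> 0 <= f x) ->
  \int[mu]_(x in A `|` B) f x <=
  \int[mu]_(x in A) f x + \int[mu]_(x in B) f x.
Proof.
move=> mA mB fA fB; apply: ge0_integral_leP => [x [/fA|/fB]//|h hf].
apply: (@le_trans _ _ (\int[mu]_x ((proj_nnsfun h mA x)%:E +
    (proj_nnsfun h mB x)%:E))).
  apply: ge0_le_integral => //; first exact: emeasurable_funD.
  move=> x _; rewrite !proj_nnsfunE !patchE; have := hf x;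
    rewrite patchE in_setU.
  by do 2 case: (_ \in _) => //=; rewrite ?adde0 ?add0e// leeDl.
rewrite ge0_integralD//; apply: leeD; apply: nnsfun_le_integral => // x;
  rewrite proj_nnsfunE !patchE; have := hf x; rewrite patchE in_setU.
  by case: (_ \in A).
by case: (_ \in B); rewrite ?orbT.
Qed.

Lemma ge0_integral_sub_bigcup_le n D (A : 'I_n -> set T) f :
  measurable D -> (forall i, measurable (A i)) -> (forall x, 0 <= f x) ->
  D `<=` \big[setU/set0]_(i < n) A i ->
  \int[mu]_(x in D) f x <= \sum_(i < n) \int[mu]_(x in A i) f x.
Proof.
move=> mD mA f0 DA.
apply: (@le_trans _ _ (\int[mu]_(x in \big[setU/set0]_(i < n) A i) f x)).
  apply: ge0_integral_leP => // h hf.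
  apply: nnsfun_le_integral => // x; apply: le_trans (hf x) _.
  by rewrite !patchE; case: (boolP (x \in D)) => [|_];
    [rewrite inE => /DA/mem_set->|case: ifP].
move=> {DA}.
have mAs (s : seq 'I_n) : measurable (\big[setU/set0]_(i <- s) A i).
  by apply: bigsetU_measurable.
elim: (index_enum _) => [|i s IH]; first by rewrite !big_nil integral_set0 lexx.
rewrite !big_cons; apply: le_trans (ge0_integral_setU_le _ _ _ _) _ => //.
by rewrite leeD2l.
Qed.

End nonneg_integral.

(** * Null sets under expansive maps *)

(** On [E] the inverse of [W] is Lipschitz with constant [1 / k], so a cover of [N] by intervals of
    small total length pulls back to a cover of comparable total length. This is what transports the
    exceptional null set of a path to the time variable of its profile. *)
Lemma negligible_expansive_preimage (R : realType) (W : R -> R) (k : R)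
    (E N : set R) : 0 < k ->
  (forall s t, E s -> E t -> k * `|s - t| <= `|W s - W t|) ->
  (@lebesgue_measure R).-negligible N ->
  (@lebesgue_measure R).-negligible (E `&` W @^-1` N).
Proof.
move=> k0 Wk; rewrite !negligible_outer_measure => N0.
apply/eqP; rewrite eq_le outer_measure_ge0 andbT.
set l := wlength idfun in N0 *.
(* Each piece of the preimage lies within [D], the interval's length divided by [k], of any one of
   its points; a two-sided neighbourhood of that radius has length [2 * D], whence the factor
   [2 / k]. *)
have lF (F : set R) : (exists ab, F = `]ab.1, ab.2[%classic) ->
    ((l^* (E `&` W @^-1` F))%mu <= (2 / k)%:E * l F)%E.
  move=> [[x y]/= ->].
  have [->|/set0P[s [Es /=]]] := eqVneq (E `&` W @^-1` `]x, y[%classic) set0.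
    by rewrite outer_measure0 mule_ge0// lee_fin ltW// divr_gt0.
  rewrite in_itv/= => /andP[xs sy].
  have xy : x < y by exact: lt_trans xs sy.
  pose D := (y - x) / k.
  have D0 : 0 < D by rewrite divr_gt0// subr_gt0.
  apply: (@le_trans _ _ (l^* (`[s - D, s + D]%classic : set R))%mu).
    apply: le_outer_measure => t [Et /=]; rewrite in_itv/= => /andP[xt ty].
    have : `|s - t| <= D.
      rewrite /D ler_pdivlMr// mulrC; apply: le_trans (Wk _ _ Es Et) _.
      by rewrite ler_norml; apply/andP; split; lra.
    by rewrite in_itv/= ler_norml => /andP[? ?]; apply/andP; split; lra.
  have -> : (l^* (`[s - D, s + D]%classic : set R))%mu =
    lebesgue_measure (`[s - D, s + D]%classic : set R) by [].
  rewrite lebesgue_measure_itv/= /l wlength_itv/= !lte_fin xy.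
  rewrite ifT; last lra.
  by rewrite -!EFinD -EFinM lee_fin /D le_eqVlt; apply/orP; left; apply/eqP;
    field; rewrite gt_eqF.
apply/lee_addgt0Pr => e e0; rewrite add0e.
have ke0 : 0 < k / 2 * e by rewrite mulr_gt0// divr_gt0.
have [_ [F [Fab NF] <-] Fe] : exists2 x, [set (\sum_(0 <= n <oo) l (F n))%E
    | F in open_itv_cover N] x & (x < (k / 2 * e)%:E)%E.
  by apply: ereal_inf_lt; rewrite -outer_measure_open_itv_cover N0 lte_fin.
apply: (@le_trans _ _ (l^* (\bigcup_n (E `&` W @^-1` F n)))%mu).
  by apply: le_outer_measure => t [Et /NF[n _ Fn]]; exists n.
apply: le_trans (outer_measure_sigma_subadditive _ _) _.
apply: (@le_trans _ _ (\sum_(0 <= n <oo) ((2 / k)%:E * l (F n)))%E).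
  by apply: lee_nneseries => [n _ _|n _];
    [exact: outer_measure_ge0|exact/lF/Fab].
rewrite nneseriesZl; last by move=> n _; exact: wlength_ge0.
have -> : e = 2 / k * (k / 2 * e) by field; rewrite gt_eqF.
by rewrite [leRHS]EFinM lee_pmul2l// ?lte_fin ?divr_gt0// ltW.
Qed.

(** * Second-order Taylor bounds at a zero *)

Section taylor.
Context {R : realType} {m : nat}.
Implicit Types (F : 'rV[R]_m -> R) (x h : 'rV[R]_m).

Lemma is_derive_line F x h (t : R) :
  derivable F (x + t *: h) h ->
  is_derive t (1 : R) (fun s : R => F (x + s *: h)) ('D_h F (x + t *: h)).
Proof.
have E : (fun k : R => k^-1 *: (((fun s : R =>
  F (x + s *: h)) \o shift t) (k *: (1 : R))
     - F (x + t *: h))) =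
   (fun k => k^-1 *: ((F \o shift (x + t *: h)) (k *: h) - F (x + t *: h))).
  apply/funext => k /=; congr (_ *: (F _ - _)).
  by rewrite -[k *: 1]/(k * 1) mulr1 scalerDl addrCA.
by move=> dF; split; rewrite /derivable /derive E.
Qed.

Lemma mx_norm_coord x i : `|x ord0 i| <= `|x|.
Proof.
rewrite [leRHS]/Num.norm/= mx_normrE.
by apply: (le_trans _ (le_bigmax _ _ (ord0, i))).
Qed.

Lemma mx_norm_le x (M : R) : 0 <= M -> (forall i, `|x ord0 i| <= M) -> `|x| <=
  M.
Proof.
move=> M0 xM; rewrite [leLHS]/Num.norm/= mx_normrE.
by apply: bigmax_le => // -[i j] _ /=; rewrite ord1.
Qed.

(** Vertices of the staircase from [0] to [h]: the first [k] coordinates of [h], then zeros. *)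
Let hcut h (k : nat) : 'rV[R]_m := \row_i (if (i < k)%N then h ord0 i else 0).

Let hcutS h (i : 'I_m) :
  hcut h i.+1 = hcut h i + h ord0 i *: delta_mx ord0 i.
Proof.
apply/rowP => j; rewrite !mxE eqxx/= ltnS leq_eqVlt.
have [ji|ji] := eqVneq j i; first by rewrite ji eqxx ltnn/= add0r mulr1.
by rewrite (negbTE (ji : (j : nat) != i)) mulr0 addr0.
Qed.

(** The increment telescopes along the staircase of [hcut], each edge of which is parallel to an
    axis, so that the mean value theorem applies with a partial derivative only. *)
Lemma coord_increments F x h :
  (forall i y, derivable F y (delta_mx ord0 i)) ->
  exists xi : 'I_m -> 'rV[R]_m, (forall i, `|xi i - x| <= `|h|) /\
    F (x + h) - F x = \sum_i h ord0 i * 'D_(delta_mx ord0 i) F (xi i).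
Proof.
move=> dF.
have step (i : 'I_m) : exists xi : 'rV[R]_m, `|xi - x| <= `|h| /\
    F (x + hcut h i.+1) - F (x + hcut h i) =
    h ord0 i * 'D_(delta_mx ord0 i) F xi.
  pose g (s : R) := F (x + hcut h i + s *: delta_mx ord0 i).
  pose dg s := 'D_(delta_mx ord0 i) F (x + hcut h i + s *: delta_mx ord0 i).
  (* Each edge is rescaled to [[0, 1]], which avoids distinguishing the sign of [h ord0 i]. *)
  have gdg (t : R) : is_derive t (1 : R) (fun t => g (t * h ord0 i))
      (h ord0 i * dg (t * h ord0 i)).
    have := is_derive_line (dF i (x + hcut h i + (t * h ord0 i) *: delta_mx
      ord0 i)).
    rewrite -/(dg (t * h ord0 i)) => gt.
    have ct : is_derive t (1 : R) (fun s : R => s * h ord0 i) (h ord0 i).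
      have -> : (fun s : R => s * h ord0 i) = h ord0 i \*: (@id R).
        by apply/funext => s; rewrite mulrC.
      by apply: is_derive_eq; rewrite -[LHS]/(_ * 1) mulr1.
    rewrite [X in is_derive _ _ _ X]mulrC.
    exact: (@is_derive1_comp _ g (fun s : R => s * h ord0 i) t _ _ gt ct).
  have [|t t01] := MVT_segment (@ler01 R) (fun t _ => gdg t).
    apply: derivable_within_continuous => t _; exact: ex_derive.
  rewrite subr0 mulr1 mul0r mul1r /g scale0r addr0 -addrA -hcutS => ->.
  exists (x + hcut h i + (t * h ord0 i) *: delta_mx ord0 i); split => //.
  rewrite -[x + _ + _]addrA [x + _]addrC addrK; apply: mx_norm_le => // j;
    rewrite !mxE eqxx/=.
  have [->|ji] := eqVneq j i.
    rewrite ltnn add0r mulr1 normrM (le_trans _ (mx_norm_coord h i))//.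
    by rewrite ler_piMl// ger0_norm ?(itvP t01).
  rewrite mulr0 addr0; case: ifP => _; last by rewrite normr0.
  exact: mx_norm_coord.
have [xi xiP] := choice step.
exists xi; split => [i|]; first by case: (xiP i).
rewrite -(eq_bigr _ (fun i _ => (xiP i).2)).
have -> : F (x + h) - F x = F (x + hcut h m) - F (x + hcut h 0).
  congr (F _ - F _); last by rewrite -[LHS]addr0; congr (_ + _);
    apply/rowP => j; rewrite !mxE.
  by congr (_ + _); apply/rowP => j; rewrite mxE ltn_ord.
by rewrite -(big_mkord predT (fun i =>
  F (x + hcut h i.+1) - F (x + hcut h i))) telescope_sumr.
Qed.

Lemma continuous_partials_near F x (e : R) : 0 < e ->
  (forall i, {for x, continuous ('D_(delta_mx ord0 i) F)}) ->
  exists2 d : R, 0 < d & forall y, `|y - x| < d -> forall i,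
    `|'D_(delta_mx ord0 i) F y - 'D_(delta_mx ord0 i) F x| < e.
Proof.
move=> e0 cF.
have : \forall y \near x, forall i,
    `|'D_(delta_mx ord0 i) F y - 'D_(delta_mx ord0 i) F x| < e.
  apply: (@filter_forall _ _ (fun i y =>
    `|'D_(delta_mx ord0 i) F y - 'D_(delta_mx ord0 i) F x| < e)
    (nbhs x) (nbhs_filter x)) => i; have /cvgrPdist_lt /(_ e e0) := cF i.
  by apply: filterS => y; rewrite distrC.
by move=> /nbhs_normP[d /= d0 dP]; exists d => // y yd; apply: dP;
  rewrite /= distrC.
Qed.

(** [Ck] speaks of coordinate directions only; continuity of the partial derivatives at [x] gives
    the derivative in every direction, because the intermediate points of [coord_increments] tend to
    [x]. *)
Lemma continuous_partials_is_derive F x h :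
  (forall i y, derivable F y (delta_mx ord0 i)) ->
  (forall i, {for x, continuous ('D_(delta_mx ord0 i) F)}) ->
  is_derive x h F (\sum_i h ord0 i * 'D_(delta_mx ord0 i) F x).
Proof.
move=> dF cF.
suff cvgF : (fun k : R => k^-1 *: ((F \o shift x) (k *: h) - F x)) @ 0^' -->
    \sum_i h ord0 i * 'D_(delta_mx ord0 i) F x.
  by split; [exact: cvgP cvgF|exact: cvg_lim cvgF].
apply/cvgrPdist_le => /= e e0.
pose S := 1 + \sum_i `|h ord0 i|.
have S0 : 0 < S by rewrite ltr_pwDl// sumr_ge0.
have [d d0 dP] := continuous_partials_near (divr_gt0 e0 S0) cF.
near=> k.
have k0 : k != 0 by near: k; exact: nbhs_dnbhs_neq.
have kd : `|k| * `|h| < d.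
  have h0 : 0 < 1 + `|h| by exact: ltr_pwDl.
  have : `|k| < d / (1 + `|h|).
    by near: k; apply: dnbhs0_lt; exact: divr_gt0.
  rewrite ltr_pdivlMr// => /le_lt_trans; apply.
  by rewrite ler_wpM2l// lerDr.
have [xi [xix /= E]] := coord_increments x (k *: h) dF.
rewrite [x + _]addrC in E; rewrite E scaler_sumr -sumrB.
apply: le_trans (ler_norm_sum _ _ _) _.
apply: (@le_trans _ _ (\sum_i `|h ord0 i| * (e / S))).
  apply: ler_sum => i _.
  rewrite mxE -[_ *: _]/(_ * _) mulrA mulKf// -mulrBr normrM ler_wpM2l// distrC
    ltW//.
  by apply: dP; apply: le_lt_trans (xix i) _; rewrite normrZ.
rewrite -mulr_suml mulrCA ler_piMr ?ltW//.
by rewrite ltr_pdivrMr// mul1r /S ltrDr.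
Unshelve. all: by end_near. Qed.

End taylor.

(** * Quadratic forms and the smallest eigenvalue *)

Lemma cvgr_sum (R : realType) (T : Type) (F : set_system T) (n : nat)
    (f : 'I_n -> T -> R) (l : 'I_n -> R) {FF : Filter F} :
  (forall i, f i x @[x --> F] --> l i) ->
  \sum_i f i x @[x --> F] --> \sum_i l i.
Proof. by move=> fl; apply: cvg_big => //; exact: add_continuous. Qed.

Section quadratic_form.
Context {R : realType} {m : nat}.
Implicit Types (H : 'M[R]_m) (x y : 'rV[R]_m).

Let quad H x y : R := (x *m H *m y^T) ord0 ord0.

Lemma enorm_ge0 x : 0 <= enorm x.
Proof. exact: sqrtr_ge0. Qed.

Lemma sqr_enorm x : enorm x ^+ 2 = \sum_i x ord0 i ^+ 2.
Proof. by rewrite sqr_sqrtr// sumr_ge0// => i _; rewrite sqr_ge0. Qed.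

Lemma sqr_enormE x : enorm x ^+ 2 = (x *m x^T) ord0 ord0.
Proof. by rewrite sqr_enorm mxE; apply: eq_bigr => i _; rewrite mxE expr2. Qed.

Lemma enormZ (k : R) x : enorm (k *: x) = `|k| * enorm x.
Proof.
rewrite /enorm -sqrtr_sqr -sqrtrM ?sqr_ge0// mulr_sumr; congr Num.sqrt.
by apply: eq_bigr => i _; rewrite mxE exprMn.
Qed.

Lemma enorm0 : enorm (0 : 'rV[R]_m) = 0.
Proof. by rewrite -(scale0r (0 : 'rV[R]_m)) enormZ normr0 mul0r. Qed.

(** Limits and Lipschitz bounds live in the sup norm, the energy in the Euclidean one. The crude
    factor [m], instead of its square root, is enough to pass between them. *)
Lemma enorm_le_mx_norm x : enorm x <= m%:R * `|x|.
Proof.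
rewrite -(@ler_pXn2r _ 2)// ?nnegrE ?enorm_ge0 ?mulr_ge0// sqr_enorm.
apply: (@le_trans _ _ (\sum_(i < m) `|x| ^+ 2)).
  by apply: ler_sum => i _; rewrite -(real_normK (num_real (x _ _))) lerXn2r
    ?nnegrE ?mx_norm_coord.
rewrite sumr_const card_ord -[leLHS]mulr_natl exprMn ler_wpM2r ?sqr_ge0//
  -natrX ler_nat.
by rewrite expnS expn1; case: (m) => // k; rewrite leq_pmulr.
Qed.

Lemma mx_norm_le_enorm x : `|x| <= enorm x.
Proof.
apply: mx_norm_le => [|i]; first exact: enorm_ge0.
rewrite -(@ler_pXn2r _ 2)// ?nnegrE ?enorm_ge0// sqr_enorm (real_normK
  (num_real _)).
by rewrite (bigD1 i)//= lerDl sumr_ge0// => j _; rewrite sqr_ge0.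
Qed.

Lemma enorm_eq0 x : enorm x = 0 -> x = 0.
Proof. by move=> x0; apply/eqP; rewrite -normr_le0 -x0 mx_norm_le_enorm. Qed.

Lemma enorm_gt0 x : x != 0 -> 0 < enorm x.
Proof.
move=> x0; rewrite lt_neqAle enorm_ge0 andbT eq_sym.
by apply: contra_neq x0; exact: enorm_eq0.
Qed.

Lemma enorm_continuous : continuous (@enorm R m).
Proof.
move=> x; apply: (@continuous_comp _ _ _ (fun x : 'rV[R]_m =>
  \sum_i x ord0 i ^+ 2) Num.sqrt).
  apply: (@cvgr_sum _ _ (nbhs x)) => i;
    apply: (continuous_comp (g := fun y : R => y ^+ 2));
    [exact: coord_continuous|exact: exprn_continuous].
exact: sqrt_continuous.
Qed.

Lemma quadratic_form_continuous H :
  continuous (fun x : 'rV[R]_m => (x *m H *m x^T) ord0 ord0).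
Proof.
have -> : (fun x : 'rV[R]_m => (x *m H *m x^T) ord0 ord0) =
    (fun x => \sum_j (\sum_k x ord0 k * H k j) * x ord0 j).
  apply/funext => x; rewrite mxE; apply: eq_bigr => j _.
  by rewrite !mxE.
move=> x; apply: (@cvgr_sum _ _ (nbhs x)) => j; apply: cvgM;
  last exact: coord_continuous.
by apply: (@cvgr_sum _ _ (nbhs x)) => k; apply: cvgM;
  [exact: coord_continuous|exact: cvg_cst].
Qed.

Let quadD H x y u v : quad H (x + y) (u + v) =
  quad H x u + quad H x v + (quad H y u + quad H y v).
Proof. by rewrite /quad linearD/= !mulmxDl !mulmxDr !mxE. Qed.

Let quadZ H k l x y : quad H (k *: x) (l *: y) = k * l * quad H x y.
Proof. by rewrite /quad linearZ/= -!scalemxAl -!scalemxAr !mxE mulrA. Qed.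

Let quadC H x y : H^T = H -> quad H x y = quad H y x.
Proof.
move=> HT; rewrite /quad.
transitivity ((x *m H *m y^T)^T ord0 ord0); first by rewrite [RHS]mxE.
by rewrite !trmx_mul trmxK HT mulmxA.
Qed.

(** With [g = x *m H], the form at [x + t *: g] is [2 * t * s + t ^+ 2 * q], where [s] is the
    squared Euclidean norm of [g]. Its nonnegativity for small negative [t] forces [s = 0]. *)
Lemma psd_isotropic_kernel H x : H^T = H -> (forall y, 0 <= quad H y y) ->
  quad H x x = 0 -> x *m H = 0.
Proof.
move=> HT Hge0 Hx0; set g := x *m H.
apply: enorm_eq0; apply/eqP; rewrite -sqrf_eq0 sqr_enormE; apply/eqP.
have gE : (g *m g^T) ord0 ord0 = quad H x g by [].
rewrite gE; set s := quad H x g; set q := quad H g g.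
have q0 : 0 <= q by exact: Hge0.
have q1 : 0 < 1 + q by rewrite ltr_pwDl.
(* The denominator [1 + q] rather than [q] covers the case [q = 0]; the value of the form becomes
   [- s ^+ 2 * (2 + q) / (1 + q) ^+ 2]. *)
have := Hge0 (x + (- s / (1 + q)) *: g).
have qZr k : quad H x (k *: g) = k * s by rewrite -{1}[x]scale1r quadZ mul1r.
have qZl k : quad H (k *: g) x = k * s.
  by rewrite -[in LHS](scale1r x) quadZ mulr1 (quadC g x HT).
rewrite quadD Hx0 qZr qZl quadZ -/q add0r => h.
have {}h : 0 <= - (s ^+ 2 * (2 + q)).
  have : 0 <= (1 + q) ^+ 2 * (- s / (1 + q) * s +
    (- s / (1 + q) * s + - s / (1 + q) * (- s / (1 + q)) * q)).
    by rewrite mulr_ge0 ?sqr_ge0.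
  rewrite [X in 0 <= X -> _](_ : _ = - (s ^+ 2 * (2 + q)))//.
  by field; rewrite gt_eqF.
have : s ^+ 2 <= 0.
  rewrite -(@pmulr_lle0 _ (2 + q)) ?ltr_pwDl//.
  by rewrite -oppr_ge0.
by move=> s2; apply/eqP; rewrite -sqrf_eq0 eq_le s2 sqr_ge0.
Qed.

End quadratic_form.

(* The Rayleigh quotient attains its minimum [mu], and a minimizer is isotropic
   for the positive semidefinite form [H - mu], hence in its kernel. *)
Lemma smallest_eigenvalue_rayleigh (R : realType) (m : nat) (H : 'M[R]_m) :
  (0 < m)%N -> H^T = H ->
  exists mu, smallest_eigenvalue H mu /\
    forall x, mu * enorm x ^+ 2 <= (x *m H *m x^T) ord0 ord0.
Proof.
case: m H => // m H _ HT.
(* The sup-norm sphere is compact in the ambient topology; since [ray] is homogeneous of degree 0,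
   its minimum there is a global one. *)
pose S := [set x : 'rV[R]_m.+1 | `|x| = 1].
pose ray x := (x *m H *m x^T) ord0 ord0 / enorm x ^+ 2.
have S_neq0 x : S x -> x != 0.
  by move=> /= x1; rewrite -normr_eq0 x1 oner_neq0.
have cS : compact S.
  apply: bounded_closed_compact.
    by exists 1; split => // M M1 x /= ->; exact: ltW.
  apply: (@closed_comp _ _ _ [set 1 : R]) => // x _; exact: norm_continuous.
have S0 : S !=set0.
  have x0 : const_mx 1 != 0 :> 'rV[R]_m.+1.
    by apply/eqP => /rowP/(_ ord0); rewrite !mxE => /eqP; rewrite oner_eq0.
  exists (`|const_mx 1 : 'rV[R]_m.+1|^-1 *: const_mx 1).
  by rewrite /S /= mx_normZ normfV normr_id mulVf// normr_eq0.
have cray : {within S, continuous ray}.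
  apply: continuous_in_subspaceT => x /[!inE] Sx.
  apply: (@cvgM _ _ (nbhs x) _ (fun y => (y *m H *m y^T) ord0 ord0)
    (fun y => (enorm y ^+ 2)^-1)); first exact: quadratic_form_continuous.
  apply: (@cvgV _ _ (nbhs x) _ (fun y => enorm y ^+ 2));
    first by rewrite sqrf_eq0 gt_eqF// enorm_gt0// S_neq0.
  by apply: (continuous_comp (g := fun y : R => y ^+ 2));
    [exact: enorm_continuous|exact: exprn_continuous].
have [x0 /[!inE] Sx0 x0min] := compact_EVT_min S0 cS cray.
set mu := ray x0.
have rayP x : mu * enorm x ^+ 2 <= (x *m H *m x^T) ord0 ord0.
  have [->|xN0] := eqVneq x 0; first by rewrite enorm0 expr0n mulr0 !mul0mx mxE.
  have : mu <= ray (`|x|^-1 *: x).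
    by apply: x0min; rewrite inE /S/= mx_normZ normfV normr_id mulVf//
      normr_eq0.
  rewrite /ray enormZ linearZ/= -!scalemxAl -!scalemxAr !mxE.
  rewrite ler_pdivlMr; last first.
    by rewrite exprn_gt0// mulr_gt0// ?enorm_gt0// normr_gt0 invr_eq0 normr_eq0.
  rewrite exprMn (real_normK (num_real _)) mulrCA [leRHS]mulrA -[in leRHS]expr2
    ler_pM2l//.
  by rewrite exprn_gt0// invr_gt0 normr_gt0.
exists mu; split => //; split => [|t /= /eigenvalueP[x xH xN0]]; last first.
  rewrite -(ler_pM2r (exprn_gt0 2 (enorm_gt0 xN0))) (le_trans (rayP x))//.
  by rewrite xH -scalemxAl mxE sqr_enormE.
apply/eigenvalueP; exists x0; last exact: S_neq0.
apply/eqP; rewrite -subr_eq0 -mul_mx_scalar -mulmxBr; apply/eqP.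
have quadB x : (x *m (H - mu%:M) *m x^T) ord0 ord0 =
    (x *m H *m x^T) ord0 ord0 - mu * enorm x ^+ 2.
  by rewrite mulmxBr mulmxBl mul_mx_scalar -scalemxAl mxE [in X in _ + X]mxE
    [in X in _ + X]mxE sqr_enormE.
apply: psd_isotropic_kernel.
- by rewrite linearB/= HT tr_scalar_mx.
- by move=> y; rewrite quadB subr_ge0.
- by rewrite quadB /mu /ray divfK ?subrr// sqrf_eq0 gt_eqF// enorm_gt0// S_neq0.
Qed.

Lemma scalerE (R : pzRingType) (k x : R) : k *: (x : R^o) = k * x.
Proof. by []. Qed.

(** Subtracting [g 1 * t ^+ 2] gives a function [p] vanishing at 0 and 1. The mean value theorem
    makes its derivative [q] vanish at some [s]; as [q] also vanishes at 0, a second application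
    yields [t]. *)
Lemma second_order_taylor (R : realType) (g dg ddg : R -> R) :
  (forall t : R, is_derive t (1 : R) g (dg t)) ->
  (forall t : R, is_derive t (1 : R) dg (ddg t)) ->
  g 0 = 0 -> dg 0 = 0 ->
  exists2 t : R, t \in `]0, 1[ & g 1 = ddg t / 2.
Proof.
move=> gP dgP g0 dg0.
pose p t := g t - g 1 * t ^+ 2.
have pP (t : R) : is_derive t (1 : R) p (dg t - g 1 * (2 * t)).
  by apply: is_derive_eq; rewrite !scalerE; ring.
pose q t := dg t - g 1 * (2 * t).
have qP (t : R) : is_derive t (1 : R) q (ddg t - g 1 * 2).
  by apply: is_derive_eq; rewrite !scalerE; ring.
have cont (f df : R -> R) (u v : R) : (forall t : R, is_derive t (1 : R) f (df
  t)) ->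
    {within `[u, v], continuous f}.
  by move=> fP; apply: derivable_within_continuous => t _; exact: ex_derive.
have [s s01] := MVT ltr01 (fun t _ => pP t) (cont _ _ 0 1 pP).
rewrite /p g0 expr1n mulr1 subrr expr0n/= mulr0 !subr0 mulr1 => /esym qs.
have s0 : 0 < s by rewrite (itvP s01).
have [t ts] := MVT s0 (fun t _ => qP t) (cont _ _ 0 s qP).
rewrite {1 2}/q qs dg0 !mulr0 !subr0 => /esym/eqP.
rewrite mulf_eq0 (gt_eqF s0) orbF subr_eq0 => /eqP E.
exists t; last by rewrite E mulfK.
by rewrite in_itv/= (itvP ts) (lt_trans _ (_ : s < 1))// (itvP s01, itvP ts).
Qed.

(** * Two-sided quadratic bounds on [F] at a zero *)

Section zero.
Context {R : realType} {m : nat}.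
Variables (F : 'rV[R]_m -> R) (xi : 'rV[R]_m) (l : R).
Hypotheses (F_C2 : Ck 2 F) (F_ge0 : forall x, 0 <= F x) (Fxi : F xi = 0).
Hypotheses (l_gt0 : 0 < l).
Hypothesis hessian_ge : forall x, l * enorm x ^+ 2 <= (x *m hessian F xi *m
  x^T) ord0 ord0.

Let D i := 'D_(delta_mx ord0 i) F.
Let DD i j := 'D_(delta_mx ord0 i) (D j).

Let dF i x : derivable F x (delta_mx ord0 i).
Proof. by case: F_C2 => _ /(_ i)[]. Qed.

Let cD i : continuous (D i).
Proof. by case: F_C2 => _ /(_ i)[_ []]. Qed.

Let dD i j x : derivable (D j) x (delta_mx ord0 i).
Proof. by case: F_C2 => _ /(_ j)[_ [_ /(_ i)[]]]. Qed.

Let cDD i j : continuous (DD i j).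
Proof. by case: F_C2 => _ /(_ j)[_ [_ /(_ i)[_ []]]]. Qed.

(** Taylor's formula along the segment from [xi] to [xi + h]. The first-order term vanishes because
    a zero of the nonnegative [F] is a minimum. *)
Lemma C2_zero_taylor h : exists2 t : R, t \in `]0, 1[ &
  F (xi + h) = (\sum_j h ord0 j * \sum_i h ord0 i * DD i j (xi + t *: h)) / 2.
Proof.
pose g (t : R) := F (xi + t *: h).
pose dg (t : R) := \sum_j h ord0 j * D j (xi + t *: h).
pose ddg (t : R) := \sum_j h ord0 j * \sum_i h ord0 i * DD i j (xi + t *: h).
have gP (t : R) : is_derive t (1 : R) g (dg t).
  have Fh := continuous_partials_is_derive h dF (fun i => @cD i (xi + t *: h)).
  have := @is_derive_line _ _ F xi h t (@ex_derive _ _ _ _ _ _ _ Fh).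
  by rewrite derive_val.
have DP j (t : R) : is_derive t (1 : R) (fun t : R => D j (xi + t *: h))
    (\sum_i h ord0 i * DD i j (xi + t *: h)).
  have Fh := continuous_partials_is_derive h (dD ^~ j) (fun i =>
    @cDD i j (xi + t *: h)).
  have := @is_derive_line _ _ (D j) xi h t (@ex_derive _ _ _ _ _ _ _ Fh).
  by rewrite derive_val.
have dgP (t : R) : is_derive t (1 : R) dg (ddg t).
  have -> : dg = \sum_j (h ord0 j \*: (fun t : R => D j (xi + t *: h))).
    by apply/funext => s; rewrite fct_sumE.
  exact: is_derive_sum.
have g0 : g 0 = 0 by rewrite /g scale0r addr0.
have dg0 : dg 0 = 0.
  have h11 : (-1 : R) < 1 by rewrite (lt_trans (ltrN10 R)).
  have d0 : is_derive (0 : R) (1 : R) g 0.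
    apply: (derive1_at_min (ltW h11)) => // [|t _].
    - by rewrite in_itv/= ltr01 ltrN10.
    - by rewrite g0 F_ge0.
  by rewrite -[LHS](@derive_val _ _ _ _ _ _ _ (gP 0)) derive_val.
have [t t01] := second_order_taylor gP dgP g0 dg0.
by rewrite /g scale1r; exists t.
Qed.

(** Near [xi] the Hessian form in Taylor's formula differs from its value at [xi] by at most
    [l / 2 * enorm h ^+ 2]. It therefore stays between [l / 2] and [B + l / 2] times [enorm h ^+ 2],
    and Taylor's formula halves both bounds. *)
Lemma C2_zero_quadratic : exists rho M : R, [/\ 0 < rho, 0 < M &
  forall h, `|h| <= rho ->
    l / 4 * enorm h ^+ 2 <= F (xi + h) /\ F (xi + h) <= M * enorm h ^+ 2].
Proof.
have m2 : 0 < m%:R ^+ 2 + 1 :> R by rewrite ltr_wpDl ?sqr_ge0.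
(* Chosen so that the [m ^ 2] entries, each perturbed by at most [eta], contribute at most [l / 2]
   altogether; the added 1 avoids a zero denominator. *)
pose eta := l / 2 / (m%:R ^+ 2 + 1).
have eta0 : 0 < eta by rewrite !divr_gt0.
have : \forall y \near xi, forall j i, `|DD i j xi - DD i j y| < eta.
  apply: (@filter_forall _ _ (fun j y =>
    forall i, `|DD i j xi - DD i j y| < eta)
    (nbhs xi) (nbhs_filter xi)) => j.
  apply: (@filter_forall _ _ (fun i y => `|DD i j xi - DD i j y| < eta)
    (nbhs xi) (nbhs_filter xi)) => i.
  by have /cvgrPdist_lt/(_ eta eta0) := @cDD i j xi.
move=> /nbhs_normP[d /= d0 dP].
pose B := \sum_j \sum_i `|DD i j xi|.
have B0 : 0 <= B by rewrite !sumr_ge0// => j _; rewrite sumr_ge0.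
exists (d / 2), ((B + l / 2) / 2); split; first by rewrite divr_gt0.
  by rewrite divr_gt0// ltr_wpDl// divr_gt0.
move=> h hd; have [t t01 FE] := C2_zero_taylor h.
set Q := \sum_j _ in FE.
pose Q0 := \sum_j h ord0 j * \sum_i h ord0 i * DD i j xi.
have Q0E : Q0 = (h *m hessian F xi *m h^T) ord0 ord0.
  rewrite mxE; apply: eq_bigr => j _; rewrite mxE mulrC mxE; congr (_ * _).
  by apply: eq_bigr => i _; rewrite mxE.
have nh i : `|h ord0 i| <= enorm h.
  exact: le_trans (mx_norm_coord _ _) (mx_norm_le_enorm _).
have e0 := enorm_ge0 h.
have Qle : `|Q - Q0| <= l / 2 * enorm h ^+ 2.
  rewrite -sumrB; apply: le_trans (ler_norm_sum _ _ _) _.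
  apply: (@le_trans _ _ (\sum_(j < m) \sum_(i < m) enorm h ^+ 2 * eta)).
    apply: ler_sum => j _; rewrite -mulrBr -sumrB normrM.
    apply: (@le_trans _ _ (enorm h * \sum_(i < m) enorm h * eta)).
      apply: ler_pM => //; apply: le_trans (ler_norm_sum _ _ _) _.
      apply: ler_sum => i _; rewrite -mulrBr normrM; apply: ler_pM => //.
      rewrite distrC ltW//; apply: dP => /=.
      rewrite opprD addrA subrr add0r normrN mx_normZ.
      rewrite (le_lt_trans (_ : _ <= 1 * `|h|))//.
        by rewrite ler_wpM2r// ger0_norm ?(itvP t01).
      by rewrite mul1r (le_lt_trans hd)// ltr_pdivrMr// ltr_pMr// ltr1n.
    by rewrite mulr_sumr; apply: ler_sum => i _; rewrite mulrA -expr2.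
  rewrite !sumr_const !card_ord -mulrnA -[leLHS]mulr_natl mulrCA mulrC.
  rewrite ler_wpM2r ?sqr_ge0// /eta mulrCA ger_pMr ?divr_gt0//.
  by rewrite ler_pdivrMr// mul1r natrM -expr2 lerDl.
have Q0le : Q0 <= B * enorm h ^+ 2.
  rewrite mulr_suml; apply: ler_sum => j _; apply: le_trans (ler_norm _) _.
  rewrite normrM expr2 mulrCA; apply: ler_pM => //.
  apply: le_trans (ler_norm_sum _ _ _) _; rewrite mulr_suml.
  by apply: ler_sum => i _; rewrite normrM mulrC ler_wpM2l.
have := hessian_ge h; rewrite -Q0E.
move: Qle; rewrite ler_norml FE => /andP[].
move: (enorm h ^+ 2) Q0le => E; split; lra.
Qed.

End zero.

(** * Exponential decay of the profile *)

Lemma lipschitz_within_continuous (R : realType) (V : normedModType R)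
    (q : R -> V) (A : set R) (L : R) :
  (forall s t, A s -> A t -> `|q s - q t| <= L * `|s - t|) ->
  {within A, continuous q}.
Proof.
move=> qL; apply/subspace_continuousP => x Ax; apply/cvgrPdist_le => e e0.
have L1 : 0 < 1 + `|L| by exact: ltr_pwDl.
apply/nbhs_normP; exists (e / (1 + `|L|)); first exact: divr_gt0.
move=> y /= xy Ay; apply: le_trans (qL _ _ Ax Ay) _.
apply: (@le_trans _ _ ((1 + `|L|) * `|x - y|)).
  by rewrite ler_wpM2r// (le_trans (ler_norm _))// lerDr.
by rewrite mulrC -ler_pdivlMr// ltW.
Qed.

Section exponential_decay.
Context {R : realType}.
Variables (y dy : R -> R).
Hypothesis yP : forall x : R, is_derive x (1 : R) y (dy x).

Let increment u v : u <= v -> exists2 t, t \in `[u, v] & y v - y u = dy t * (v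
  - u).
Proof.
move=> uv; apply: MVT_segment => //.
by apply: derivable_within_continuous => x _; exact: ex_derive.
Qed.

Lemma ge0_derive_le u v : (forall x, 0 <= dy x) -> u <= v -> y u <= y v.
Proof.
move=> dy0 uv; have [t _ E] := increment uv.
by rewrite -subr_ge0 E mulr_ge0// subr_ge0.
Qed.

(** If [y] stayed above [d] on the negative half-line, its slope would be at least [mu] there, and
    [y] would be nonpositive at [- (y 0 / mu)]. *)
Lemma gt0_derive_reach d mu : (forall x, 0 < y x) -> 0 < mu ->
  (forall x, x <= 0 -> d < y x -> mu <= dy x) ->
  exists2 x, x <= 0 & y x <= d.
Proof.
move=> y0 mu0 dmu; apply: contrapT => h.
have {}h x : x <= 0 -> d < y x.
  by move=> x0; rewrite ltNge; apply/negP => ?; apply: h; exists x.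
have u0 : - (y 0 / mu) <= 0 by rewrite oppr_le0 divr_ge0// ltW.
have [t] := increment u0; rewrite in_itv/= => /andP[_ t0].
rewrite sub0r opprK => E.
have := dmu t t0 (h t t0) => mut.
have : mu * (y 0 / mu) <= dy t * (y 0 / mu) by rewrite ler_wpM2r// divr_ge0//
  ltW.
rewrite -E mulrC divfK ?gt_eqF//.
by have := y0 (- (y 0 / mu)) => ?; lra.
Qed.

(** A Gronwall estimate run backwards: [y x * expR (- (k * x))] is nondecreasing up to [x0]. *)
Lemma ge_derive_exp_decay k x0 : (forall x, x <= x0 -> k * y x <= dy x) ->
  forall x, x <= x0 -> y x <= y x0 * expR (- (k * x0)) * expR (k * x).
Proof.
move=> ky x xx0; pose p t := y t * expR (- (k * t)).
have pP (t : R) : is_derive t (1 : R) p ((dy t - k * y t) * expR (- (k * t))).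
  by apply: is_derive_eq; rewrite !scalerE; ring.
have [|t] := MVT_segment xx0 (fun t _ => pP t).
  by apply: derivable_within_continuous => t _; exact: ex_derive.
rewrite in_itv/= => /andP[_ tx0] E.
have : p x <= p x0.
  rewrite -subr_ge0 E !mulr_ge0 ?expR_ge0 ?subr_ge0//.
  by rewrite ky.
rewrite /p expRN => h; rewrite -[leLHS](@divfK _ (expR (k * x))) ?gt_eqF
  ?expR_gt0//.
by rewrite ler_wpM2r ?expR_ge0.
Qed.

End exponential_decay.

(** * Decay at one end of a path, with the endpoint moved to parameter 0 *)

Section endpoint.
Context {R : realType} {m : nat}.
Variables (F : 'rV[R]_m -> R) (xi : 'rV[R]_m) (q : R -> 'rV[R]_m) (y : R -> R).
Variables (l rho D L c sigma : R).
Hypotheses (F_cont : continuous F) (F_ge0 : forall x, 0 <= F x).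
Hypotheses (l_gt0 : 0 < l) (rho_gt0 : 0 < rho) (c_gt0 : 0 < c).
Hypotheses (sigma_gt0 : 0 < sigma).
Hypothesis F_ge : forall h, `|h| <= rho -> l / 4 * enorm h ^+ 2 <= F (xi + h).
Hypothesis q_lip : forall s t, s \in `[0, D] -> t \in `[0, D] ->
  `|q s - q t| <= L * `|s - t|.
Hypotheses (q0 : q 0 = xi) (q_neq0 : forall s, s \in `]0, D[ -> F (q s) <> 0).
Hypothesis q_near : \forall s \near 0^'+, c * s <= enorm (q s - xi).
Hypothesis y_itv : forall x, y x \in `]0, D[.

Let speed s := sigma^-1 * Num.sqrt (2 * F (q s)).

Hypothesis yP : forall x : R, is_derive x (1 : R) y (speed (y x)).

Let speed_ge0 s : 0 <= speed s.
Proof. by rewrite mulr_ge0 ?sqrtr_ge0// invr_ge0 ltW. Qed.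

(** The Lipschitz bound keeps [q s] in the ball where [F] dominates [l / 4] times the squared
    distance to [xi], and that distance is at least [c * s]; hence [Num.sqrt (2 * F (q s))] is at
    least [c * s * Num.sqrt (l / 2)]. *)
Let speed_near : \forall s \near 0^'+, c / sigma * Num.sqrt (l / 2) * s <=
  speed s.
Proof.
have D0 : 0 < D by have := y_itv 0; rewrite in_itv/= => /andP[/lt_trans]; apply.
have L1 : 0 < 1 + `|L| by exact: ltr_pwDl.
near=> s.
have s0 : 0 < s by near: s; exact: nbhs_right_gt.
have sD : s < D by near: s; exact: nbhs_right_lt.
have qs : c * s <= enorm (q s - xi) by near: s.
have qrho : `|q s - xi| <= rho.
  have : s <= rho / (1 + `|L|) by near: s; apply: nbhs_right_le;
    exact: divr_gt0.
  rewrite ler_pdivlMr// => h; apply: le_trans h.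
  rewrite -q0; apply: le_trans (q_lip _ _) _;
    rewrite ?in_itv/= ?lexx ?(ltW s0) ?(ltW sD) ?(ltW D0)//.
  rewrite subr0 gtr0_norm// mulrC ler_pM2l// (le_trans (ler_norm _))//.
  by rewrite lerDr.
have := F_ge qrho; rewrite [xi + _]addrC subrK => Fqs.
rewrite /speed (_ : _ * s = sigma^-1 * (c * s * Num.sqrt (l / 2)));
  last by ring.
rewrite ler_pM2l ?invr_gt0//.
rewrite -(@ler_pXn2r _ 2)// ?nnegrE ?sqrtr_ge0//; last first.
  by rewrite !mulr_ge0 ?sqrtr_ge0 ?(ltW c_gt0) ?(ltW s0).
have cs2 : (c * s) ^+ 2 <= enorm (q s - xi) ^+ 2.
  by rewrite lerXn2r// nnegrE ?enorm_ge0// mulr_ge0// ltW.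
rewrite [leLHS]exprMn !sqr_sqrtr ?mulr_ge0 ?divr_ge0 ?(ltW l_gt0)//.
have : l / 4 * (c * s) ^+ 2 <= l / 4 * enorm (q s - xi) ^+ 2.
  by rewrite ler_wpM2l// divr_ge0// ltW.
by move=> h; lra.
Unshelve. all: by end_near. Qed.

(** Two stages, going back in time: away from 0 the speed is bounded below, so [y] drops to some [d]
    at a finite time [x0]; below [d] the linear bound on the speed gives the exponential. The bound
    by [eta] serves to stay in the ball of radius [rho]. *)
Lemma endpoint_decay eta : 0 < eta -> exists X C : R, 0 < C /\
  forall x, x <= X ->
    y x <= eta /\ y x <= C * expR (c / sigma * Num.sqrt (l / 2) * x).
Proof.
move=> eta0.
have y0 x : 0 < y x by have := y_itv x; rewrite in_itv/= => /andP[].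
have yD x : y x < D by have := y_itv x; rewrite in_itv/= => /andP[].
have [d [d0 deta dP]] : exists d, [/\ 0 < d, d <= eta & forall s, 0 < s -> s <=
  d ->
    c / sigma * Num.sqrt (l / 2) * s <= speed s].
  have := speed_near; rewrite near_withinE => /nbhs_normP[d /= d0 dP].
  exists (Num.min (d / 2) eta); split; first by rewrite lt_min eta0 divr_gt0.
    by rewrite ge_min lexx orbT.
  move=> s s0; rewrite le_min => /andP[sd _]; apply: dP => //=.
  by rewrite sub0r normrN gtr0_norm// (le_lt_trans sd)// ltr_pdivrMr//
    ltr_pMr// ltr1n.
(* The minimum of the speed over [[d, y 0]], positive because the path meets no zero of [F] inside.
   If [y 0 < d] that interval is empty and any [mu] will do. *)
have [mu mu0 muP] : exists2 mu, 0 < mu & forall s, d <= s -> s <= y 0 -> mu <=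
  speed s.
  have [dy|] := leP d (y 0); last first.
    by move=> yd; exists 1 => // s /(lt_le_trans yd)/lt_le_trans h /h;
      rewrite ltxx.
  have cF : {within `[d, y 0], continuous (fun s => F (q s))}.
    have qc : {within `[d, y 0], continuous q}.
      apply: (@lipschitz_within_continuous _ _ _ _ L) => s t.
      rewrite /= !in_itv/= => /andP[ds sy] /andP[dt ty].
      apply: q_lip; rewrite in_itv/=; apply/andP; split.
      - exact: le_trans (ltW d0) ds.
      - exact: le_trans sy (ltW (yD 0)).
      - exact: le_trans (ltW d0) dt.
      - exact: le_trans ty (ltW (yD 0)).
    by move=> x; apply: continuous_comp; [exact: qc|exact: F_cont].
  have [s0 s0I s0min] := EVT_min dy cF.
  exists (speed s0).
    rewrite mulr_gt0 ?invr_gt0// sqrtr_gt0 mulr_gt0// lt_neqAle F_ge0 andbT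
      eq_sym.
    apply/eqP/q_neq0; move: s0I; rewrite !in_itv/= => /andP[? ?].
    by rewrite (lt_le_trans d0)//= (le_lt_trans _ (yD 0)).
  move=> s ds sy; rewrite ler_pM2l ?invr_gt0// ler_sqrt ?mulr_ge0// ler_pM2l//.
  by apply: s0min; rewrite in_itv/= ds.
have [x0 x00 yx0] : exists2 x, x <= 0 & y x <= d.
  apply: (gt0_derive_reach yP y0 mu0) => x x0 /ltW dyx; apply: muP => //.
  exact: (ge0_derive_le yP).
exists x0, (y x0 * expR (- (c / sigma * Num.sqrt (l / 2) * x0))); split.
  by rewrite mulr_gt0 ?expR_gt0.
have yle x : x <= x0 -> y x <= d.
  by move=> xx0; apply: le_trans yx0; exact: (ge0_derive_le yP).
move=> x xx0; split; first exact: le_trans (yle x xx0) deta.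
by apply: (ge_derive_exp_decay yP) xx0 => t tx0; apply: dP => //; exact: yle.
Qed.

(** The distance to [xi] is at most a multiple of [expR (k * (1 - r / eps))]. Its square carries
    [expR (2 * k)], absorbed in the constant, and [expR (- (2 * k * r / eps))], where [2 * k * r] is
    the bound on [A]. *)
Lemma endpoint_transition_small (r A : R) :
  0 < r -> A <= c / sigma * r * Num.sqrt (2 * l) ->
  exists eps0 C : R, [/\ 0 < eps0, 0 < C & forall eps, 0 < eps < eps0 ->
    `|q (y (1 - r / eps)) - xi| <= rho /\
    enorm (q (y (1 - r / eps)) - xi) ^+ 2 <= C * expR (- (A / eps))].
Proof.
move=> r0 Ar; set k := c / sigma * Num.sqrt (l / 2).
have L1 : 0 < 1 + `|L| by exact: ltr_pwDl.
have [X [C [C0 XC]]] := endpoint_decay (divr_gt0 rho_gt0 L1).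
pose B := m%:R * (1 + `|L|) * C.
(* For [eps] below this value [1 - r / eps] is less than the opposite of the absolute value of [X],
   hence lies in the decay region. The summand 1 keeps the constant positive even if [B] is 0. *)
exists (r / (1 + `|X|)), (1 + B ^+ 2 * expR (2 * k)); split.
- by rewrite divr_gt0// ltr_pwDl.
- by rewrite ltr_pwDl// mulr_ge0 ?sqr_ge0 ?expR_ge0.
move=> eps /andP[e0 eX].
have X1 : 1 - r / eps <= X.
  move: eX; rewrite ltr_pdivlMr ?ltr_pwDl// mulrC -ltr_pdivlMr// => h.
  have : - `|X| <= X by rewrite lerNl -normrN ler_norm.
  by lra.
set x := 1 - r / eps in X1 *.
have [yr yC] := XC x X1.
have := y_itv x; rewrite in_itv/= => /andP[y0 yD].
have qy : `|q (y x) - xi| <= (1 + `|L|) * y x.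
  rewrite -q0; apply: le_trans (q_lip _ _) _;
    rewrite ?in_itv/= ?lexx ?(ltW y0) ?(ltW yD)//.
    by rewrite (le_trans (ltW y0) (ltW yD)).
  rewrite subr0 gtr0_norm// ler_wpM2r ?(ltW y0)// (le_trans (ler_norm _))//.
  by rewrite lerDr.
split; first by apply: le_trans qy _; rewrite mulrC -ler_pdivlMr.
have qe : enorm (q (y x) - xi) <= B * expR (k * x).
  apply: le_trans (enorm_le_mx_norm _) _.
  have -> : B * expR (k * x) = m%:R * ((1 + `|L|) * (C * expR (k * x))) by
    rewrite /B !mulrA.
  by rewrite ler_wpM2l// (le_trans qy)// ler_wpM2l.
apply: (@le_trans _ _ ((B * expR (k * x)) ^+ 2)).
  by rewrite lerXn2r ?nnegrE ?enorm_ge0// (le_trans (enorm_ge0 _) qe).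
rewrite exprMn -expRM_natl.
apply: (@le_trans _ _ (B ^+ 2 * expR (2 * k) * expR (- (A / eps)))); last first.
  by rewrite ler_wpM2r ?expR_ge0// lerDr.
rewrite -mulrA ler_wpM2l ?sqr_ge0// -expRD ler_expR.
have k2 : 2 * k = c / sigma * Num.sqrt (2 * l).
  rewrite (_ : 2 * l = 2 ^+ 2 * (l / 2)); last by field.
  by rewrite sqrtrM ?sqr_ge0// sqrtr_sqr ger0_norm// /k; ring.
rewrite mulrA k2 /x mulrBr mulr1 lerD2l lerN2 mulrA ler_wpM2r ?invr_ge0 ?(ltW
  e0)//.
by apply: le_trans Ar _; rewrite mulrAC.
Qed.

End endpoint.

(** * Energy of a transition layer *)

Lemma within_continuous_comp (T U V : topologicalType) (A : set T)
    (f : T -> U) (g : U -> V) :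
  {within A, continuous f} -> continuous g -> {within A, continuous (g \o f)}.
Proof. by move=> cf cg x; apply: (@continuous_comp (subspace A));
  [exact: cf|exact: cg]. Qed.

(** The two endpoints form a null set. Path and layer information is available on open intervals,
    while the energies are integrals over closed ones. *)
Lemma ae_itvcc (R : realType) (x0 x1 : R) (P : R -> Prop) :
  {ae @lebesgue_measure R, forall x, x \in `]x0, x1[ -> P x} ->
  {ae @lebesgue_measure R, forall x, `[x0, x1]%classic x -> P x}.
Proof.
move=> NP.
have N1 (x : R) : (@lebesgue_measure R).-negligible [set x].
  by exists [set x]; split => //; exact: lebesgue_measure_set1.
apply: negligibleS (negligibleU (negligibleU NP (N1 x0)) (N1 x1)) => x /= nP.
apply: contrapT => /not_orP[/not_orP[/contrapT xP x0x x1x]]; apply: nP.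
rewrite in_itv/= => /andP[]; rewrite !le_eqVlt.
move=> /predU1P[/esym//|xx0] /predU1P[//|xx1].
by apply: xP; rewrite in_itv/= xx0.
Qed.

Lemma derive1_itvoo (R : realType) (V : normedModType R) (f g : R -> V) (x0 x1
  x : R) :
  (forall t, t \in `]x0, x1[ -> f t = g t) -> x \in `]x0, x1[ ->
  derive1 f x = derive1 g x.
Proof.
move=> fg xI; rewrite !derive1E; apply: near_eq_derive.
by have := near_in_itvoo xI; apply: filterS => t /fg.
Qed.

Section energy.
Context {R : realType} {m : nat}.
Variables (F : 'rV[R]_m -> R).
Hypotheses (F_ge0 : forall x, 0 <= F x).

Definition energy_density (eps : R) (u : R -> 'rV[R]_m) (x : R) : \bar R :=
  (eps / 2 * enorm (derive1 u x) ^+ 2 + F (u x) / eps)%:E.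

Lemma energy_density_ge0 eps u x : 0 < eps -> (0 <= energy_density eps u x)%E.
Proof.
move=> e0; rewrite lee_fin; apply: addr_ge0; last by rewrite divr_ge0// ltW.
by rewrite mulr_ge0 ?sqr_ge0// divr_ge0// ltW.
Qed.

(** On a piece of length [eps] and slope [1 / eps] in absolute value, both terms of the density are
    at most a constant times [enorm q ^+ 2 / eps]. Only the square of [s] is prescribed, so that the
    same bound serves the two ends of a layer. *)
Lemma affine_piece_energy (eps x0 s t rho M : R) (u : R -> 'rV[R]_m)
    (xi q : 'rV[R]_m) : 0 < eps -> 0 <= M -> s ^+ 2 = eps ^- 2 ->
  (forall h, `|h| <= rho -> F (xi + h) <= M * enorm h ^+ 2) -> `|q| <= rho ->
  (forall x, x \in `]x0, x0 + eps[ ->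
    0 <= s * x + t <= 1 /\ u x = xi + (s * x + t) *: q) ->
  (\int[lebesgue_measure]_(x in `[x0, (x0 + eps)%R]) energy_density eps u x <=
    ((1 / 2 + M) * enorm q ^+ 2)%:E)%E.
Proof.
move=> e0 M0 s2 FM qrho uE.
pose K := (1 / 2 + M) * enorm q ^+ 2 / eps.
have K0 : 0 <= K by rewrite divr_ge0 ?(ltW e0)// mulr_ge0 ?sqr_ge0// addr_ge0//
  divr_ge0.
have -> : ((1 / 2 + M) * enorm q ^+ 2)%:E =
    (\int[lebesgue_measure]_(x in `[x0, (x0 + eps)%R]) (cst K%:E) x)%E.
  rewrite integral_cst//= lebesgue_measure_itv/= lte_fin ltrDl e0 -EFinB -EFinM.
  by rewrite [x0 + eps]addrC addrK divfK// gt_eqF.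
apply: ge0_integral_ae_le => //.
- by move=> x _; apply: energy_density_ge0.
apply: ae_itvcc; apply: aeW => x xI.
have [/andP[th0 th1] ux] := uE x xI.
have -> : energy_density eps u x =
   (enorm q ^+ 2 / 2 / eps + F (xi + (s * x + t) *: q) / eps)%:E.
  have dux : is_derive x (1 : R) (fun x : R => xi + (s * x + t) *: q) (s *: q).
    have -> : (fun x : R => xi + (s * x + t) *: q) =
        cst (xi + t *: q) + (fun x : R => x *: (s *: q)).
      apply/funext => y; rewrite -[RHS]/(xi + t *: q + y *: (s *: q)).
      by rewrite scalerA -addrA -scalerDl [y * s]mulrC [t + _]addrC.
    have dl : is_derive x (1 : R) (fun x : R => x *: (s *: q)) (s *: q).
      apply: DeriveDef; first exact/diff_derivable/ex_diff.
      by rewrite deriveE ?diff_val ?scale1r//; exact: ex_diff.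
    apply: is_derive_eq (is_deriveD (is_derive_cst (xi + t *: q) x (1 : R)) dl) _.
    by rewrite add0r.
  rewrite /energy_density ux (derive1_itvoo (fun t tI =>
    (uE t tI).2) xI) derive1E derive_val.
  by rewrite enormZ exprMn (real_normK (num_real _)) s2; congr (_%:E); field;
    rewrite gt_eqF.
rewrite lee_fin /K -mulrDl ler_pM2r ?invr_gt0// mulrDl mulrC mul1r lerD2l.
set th := s * x + t in th0 th1 *.
have thq : `|th *: q| <= rho.
  by rewrite mx_normZ (le_trans _ qrho)// ler_piMl// ger0_norm.
apply: le_trans (FM _ thq) _; rewrite ler_wpM2l//.
rewrite lerXn2r ?nnegrE ?enorm_ge0// enormZ ler_piMl ?enorm_ge0//.
by rewrite ger0_norm.
Qed.

Lemma derive1_comp_scalar (psi : R -> 'rV[R]_m) (W : R -> R) (x : R) :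
  derivable W x 1 -> derivable psi (W x) 1 ->
  derive1 (psi \o W) x = derive1 W x *: derive1 psi (W x).
Proof.
move=> /derivable1_diffP dW /derivable1_diffP dpsi.
rewrite derive1E'; last exact: differentiable_comp.
rewrite diff_comp// /= -derive1E'// deriv1E//.
by apply/derivable1_diffP.
Qed.

Variables (a b eps sigma : R) (psi : R -> 'rV[R]_m) (W : R -> R).
Hypotheses (eps_gt0 : 0 < eps) (sigma_gt0 : 0 < sigma).
Hypothesis F_cont : continuous F.
Hypothesis psi_cont : {within `[a, b], continuous psi}.
Hypothesis psi_ae : {ae (@lebesgue_measure R), forall s, s \in `]a, b[ ->
  derivable psi s 1 /\ enorm (derive1 psi s) = sigma}.
Hypothesis psi_neq0 : forall s, s \in `]a, b[ -> F (psi s) <> 0.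
Hypothesis W_itv : forall x, W x \in `]a, b[.
Hypothesis dW : forall x, derivable W x 1.
Hypothesis cdW : continuous (derive1 W).
Hypothesis WE : forall x, derive1 W x = (eps * sigma)^-1 * Num.sqrt (2 * F (psi
  (W x))).

Let dW_gt0 x : 0 < derive1 W x.
Proof.
rewrite WE mulr_gt0 ?invr_gt0 ?mulr_gt0// sqrtr_gt0 mulr_gt0//.
by rewrite lt_neqAle F_ge0 andbT eq_sym; apply/eqP/psi_neq0.
Qed.

Let W_incr u v : u <= v -> exists2 t, t \in `[u, v] & W v - W u = derive1 W t *
  (v - u).
Proof.
move=> uv; apply: MVT_segment => //.
  by move=> x _; rewrite derive1E; exact: derivableP.
by apply: derivable_within_continuous => x _; exact: dW.
Qed.

(** The derivative of [W] is continuous and positive, hence bounded below on a compact interval;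
    [negligible_expansive_preimage] then applies. *)
Let W_expansive x0 x1 : x0 <= x1 -> exists2 k, 0 < k &
  forall s t, `[x0, x1]%classic s -> `[x0, x1]%classic t -> k * `|s - t| <= `|W
    s - W t|.
Proof.
move=> x01; have [|x xI xmin] := @EVT_min _ (derive1 W) x0 x1 x01.
  by apply: continuous_subspaceT => x; exact: cdW.
exists (derive1 W x) => //.
have main s t : s \in `[x0, x1] -> t \in `[x0, x1] -> s <= t ->
    derive1 W x * `|s - t| <= `|W s - W t|.
  rewrite !in_itv/= => /andP[x0s sx1] /andP[x0t tx1] st.
  have [y /[!in_itv]/= /andP[sy yt] E] := W_incr st.
  rewrite distrC [leRHS]distrC E normrM ler_wpM2r//.
  rewrite (le_trans _ (ler_norm _))// xmin// in_itv/=.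
  by rewrite (le_trans x0s sy) (le_trans yt tx1).
move=> s t /= sI tI; have [st|/ltW ts] := leP s t; first exact: main.
by rewrite distrC [leRHS]distrC; exact: main.
Qed.

(** The integrand of [J] with the speed of [psi] replaced by its almost everywhere value [sigma]: it
    is continuous, as the substitution rule requires. *)
Let G0 s := Num.sqrt (F (psi s)) * sigma.

Let G0_cont : {within `[a, b], continuous G0}.
Proof.
have cs : continuous (fun y : R => y * sigma) by move=> y;
  exact: mulrr_continuous.
exact: within_continuous_comp
  (within_continuous_comp (within_continuous_comp psi_cont F_cont)
    (@sqrt_continuous R)) cs.
Qed.

Let G0_ge0 s : 0 <= G0 s.
Proof. by rewrite mulr_ge0 ?sqrtr_ge0// ltW. Qed.

(** Here [W] stands for the profile rescaled by [eps]. The density is compared almost everywhere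
    with [G (W x)] times the derivative of [W]; substitution gives the integral of [G] over
    [[W x0, W x1]], which is enlarged to [[a, b]], where [G] is almost everywhere the integrand of
    [J]. *)
Lemma transition_piece_energy x0 x1 (u : R -> 'rV[R]_m) : x0 <= x1 ->
  (forall x, x \in `]x0, x1[ -> u x = psi (W x)) ->
  (\int[lebesgue_measure]_(x in `[x0, x1]) energy_density eps u x <= J F a b
    psi)%E.
Proof.
move=> x01 uE.
pose G s := Num.sqrt 2 * G0 s.
have G_cont : {within `[a, b], continuous G}.
  have cs : continuous (fun y : R => Num.sqrt 2 * y) by move=> y;
    exact: mulrl_continuous.
  exact: within_continuous_comp G0_cont cs.
have cW x : {for x, continuous W}.
  by apply/differentiable_continuous/derivable1_diffP; exact: dW.
have Wab : `[W x0, W x1] `<=` `[a, b].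
  have := W_itv x0; have := W_itv x1;
    rewrite !in_itv/= => /andP[_ ?] /andP[? _].
  by apply: subset_itv; rewrite bnd_simp ltW.
apply: (@le_trans _ _ (\int[lebesgue_measure]_(x in `[x0, x1])
    (((G \o W) * derive1 W) x)%:E)%E).
  apply: ge0_integral_ae_le => //.
  - by move=> x _; apply: energy_density_ge0.
  - by move=> x _; rewrite lee_fin mulr_ge0 ?mulr_ge0 ?sqrtr_ge0// ltW.
  (* The times at which [W] hits a bad parameter of [psi] form a null set, so the chain rule holds
     at almost every time. *)
  have [k k0 kW] := W_expansive x01.
  have := negligible_expansive_preimage k0 kW psi_ae.
  move=> Nneg; apply: ae_itvcc; apply: negligibleS Nneg =>
    x /= /not_implyP[xI nle].
  split; first exact: subset_itv_oo_cc xI.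
  move=> /(_ (W_itv x))[dpsi epsi]; apply: nle.
  rewrite lee_fin uE// (derive1_itvoo uE xI) (_ : (fun _ => _) = psi \o W)//.
  rewrite derive1_comp_scalar// enormZ epsi exprMn (real_normK (num_real _)).
  rewrite -[leRHS]/(Num.sqrt 2 * (Num.sqrt (F (psi (W x))) * sigma) * derive1 W
    x).
  (* Equipartition: with [S ^+ 2 = 2 * F], both terms of the density equal [S ^+ 2 / (2 * eps)], and
     the right-hand side is [S ^+ 2 / eps]. *)
  rewrite mulrA -sqrtrM// WE; set S := Num.sqrt _.
  have S2 : F (psi (W x)) = S ^+ 2 / 2 by rewrite sqr_sqrtr ?mulr_ge0//; field.
  by rewrite S2 le_eqVlt; apply/orP; left; apply/eqP; field; rewrite !gt_eqF.
rewrite -integration_by_substitution_increasing//; first last.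
- exact: continuous_subspaceW Wab G_cont.
- split; first by move=> x _; exact: dW.
    exact: cvg_at_right_filter (cW x0).
  exact: cvg_at_left_filter (cW x1).
- by apply: (cvgP (derive1 W x1)); apply: cvg_at_left_filter; exact: cdW.
- by apply: (cvgP (derive1 W x0)); apply: cvg_at_right_filter; exact: cdW.
- move=> u0 v0 _ _ uv; have [t _ E] := W_incr (ltW uv).
  by rewrite -subr_gt0 E mulr_gt0// subr_gt0.
have mG0 : measurable_fun `[a, b] (EFin \o G0).
  by apply/measurable_EFinP; apply: subspace_continuous_measurable_fun.
apply: (@le_trans _ _ (\int[lebesgue_measure]_(s in `[a, b]) (G s)%:E)%E).
  apply: ge0_subset_integral => //.
  - by apply/measurable_EFinP; apply: subspace_continuous_measurable_fun.
  - by move=> s _; rewrite lee_fin mulr_ge0 ?sqrtr_ge0.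
rewrite /G /J; under eq_integral do rewrite EFinM.
rewrite ge0_integralZl//; last by move=> s _; rewrite lee_fin.
rewrite lee_wpmul2l ?lee_fin ?sqrtr_ge0//.
apply: ge0_integral_ae_le => //.
- by move=> s _; rewrite lee_fin.
- by move=> s _; rewrite lee_fin mulr_ge0 ?sqrtr_ge0 ?enorm_ge0.
apply: ae_itvcc; apply: negligibleS psi_ae => s /= nle sP; apply: nle => sI.
by rewrite /G0 (sP sI).2.
Qed.

End energy.

(** * Energy of one complete layer *)

Section transition.
Context {R : realType} {m : nat}.
Variables (F : 'rV[R]_m -> R) (a b : R).
Hypotheses (F_cont : continuous F) (F_ge0 : forall x, 0 <= F x).

Definition quadratic_zero (l : R) (xi : 'rV[R]_m) := exists rho M : R, [/\ 0 <
  rho, 0 < M &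
  forall h, `|h| <= rho ->
    l / 4 * enorm h ^+ 2 <= F (xi + h) /\ F (xi + h) <= M * enorm h ^+ 2].

Variables (l c sigma : R) (xim xip : 'rV[R]_m) (psi : R -> 'rV[R]_m) (w : R ->
  R).
Hypotheses (l_gt0 : 0 < l) (c_gt0 : 0 < c).
Hypotheses (xim_zero : quadratic_zero l xim) (xip_zero : quadratic_zero l xip).
Hypotheses (psiP : optimal_path F a b c xim xip sigma psi).
Hypotheses (wP : profile F a b sigma psi w).

(** The branch of [u0] for a single jump at [g], free of the choice of an index. *)
Definition transition_profile (g r eps x : R) : 'rV[R]_m :=
  if x < g - r + eps then
    xim + ((x - g + r) / eps) *: (psi (w (1 - r / eps)) - xim)
  else if x <= g + r - eps then psi (w ((x - g) / eps))
  else xip + ((g + r - x) / eps) *: (psi (w (r / eps - 1)) - xip).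

Let psi_lip : exists L, forall s t, s \in `[a, b] -> t \in `[a, b] ->
  `|psi s - psi t| <= L * `|s - t|.
Proof.
have [[M [_ /(_ (M + 1) _) ML]] _ _ _ _] := psiP.
exists (M + 1) => s t sI tI; have := ML _ (s, t); rewrite /= => -> //.
by rewrite ltrDl.
Qed.

Let sigma_gt0 : 0 < sigma. Proof. by have [_ _ [] ] := psiP. Qed.

Let wd x : is_derive x (1 : R) w (sigma^-1 * Num.sqrt (2 * F (psi (w x)))).
Proof.
have [_ [dw _] wE _] := wP.
by rewrite -wE derive1E; exact/derivableP.
Qed.

Let left_small r A : 0 < r -> A <= c / sigma * r * Num.sqrt (2 * l) ->
  forall rho, 0 < rho ->
  (forall h, `|h| <= rho -> l / 4 * enorm h ^+ 2 <= F (xim + h)) ->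
  exists eps0 C : R, [/\ 0 < eps0, 0 < C & forall eps, 0 < eps < eps0 ->
    `|psi (w (1 - r / eps)) - xim| <= rho /\
    enorm (psi (w (1 - r / eps)) - xim) ^+ 2 <= C * expR (- (A / eps))].
Proof.
move=> r0 Ar rho rho0 Frho; have [L psiL] := psi_lip.
have [_ [psia psib] _ _ [psi_neq0 psi_nearm psi_nearp]] := psiP.
have [wI _ _ _] := wP.
have E t : a + (t - a) = t by rewrite addrC subrK.
pose q s := psi (a + s); pose y x := w x - a.
suff [e [C [e0 C0 H]]] : exists eps0 C : R, [/\ 0 < eps0, 0 < C &
    forall eps, 0 < eps < eps0 -> `|q (y (1 - r / eps)) - xim| <= rho /\
    enorm (q (y (1 - r / eps)) - xim) ^+ 2 <= C * expR (- (A / eps))].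
  by exists e, C; split => // eps /H; rewrite /q /y E.
apply: (@endpoint_transition_small _ _ F xim q y l rho (b - a) L c sigma) => //.
- move=> s t; rewrite !in_itv/= => /andP[s0 sb] /andP[t0 tb].
  rewrite (_ : s - t = (a + s) - (a + t)); last by ring.
  by apply: psiL; rewrite in_itv/=; apply/andP; split; lra.
- by rewrite /q addr0.
- move=> s; rewrite in_itv/= => /andP[s0 sb]; apply: psi_neq0.
  by rewrite in_itv/=; apply/andP; split; lra.
- have := psi_nearm; rewrite nbhs_right0P; apply: filterS => s.
  by rewrite [a + s]addrC addrK addrC.
- move=> x; have := wI x; rewrite !in_itv/= => /andP[? ?].
  by rewrite /y; apply/andP; split; lra.
- move=> x; rewrite /q /y E; have wdx := wd x.
  by apply: is_derive_eq; rewrite subr0.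
Qed.

(** The reflection [q s = psi (b - s)], [y x = b - w (- x)] turns the right end into a left one: the
    two sign changes cancel, so [y] solves the same kind of equation. *)
Let right_small r A : 0 < r -> A <= c / sigma * r * Num.sqrt (2 * l) ->
  forall rho, 0 < rho ->
  (forall h, `|h| <= rho -> l / 4 * enorm h ^+ 2 <= F (xip + h)) ->
  exists eps0 C : R, [/\ 0 < eps0, 0 < C & forall eps, 0 < eps < eps0 ->
    `|psi (w (r / eps - 1)) - xip| <= rho /\
    enorm (psi (w (r / eps - 1)) - xip) ^+ 2 <= C * expR (- (A / eps))].
Proof.
move=> r0 Ar rho rho0 Frho; have [L psiL] := psi_lip.
have [_ [psia psib] _ _ [psi_neq0 psi_nearm psi_nearp]] := psiP.
have [wI _ _ _] := wP.
pose q s := psi (b - s); pose y x := b - w (- x).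
suff [e [C [e0 C0 H]]] : exists eps0 C : R, [/\ 0 < eps0, 0 < C &
    forall eps, 0 < eps < eps0 -> `|q (y (1 - r / eps)) - xip| <= rho /\
    enorm (q (y (1 - r / eps)) - xip) ^+ 2 <= C * expR (- (A / eps))].
  by exists e, C; split => // eps /H; rewrite /q /y subKr opprB.
apply: (@endpoint_transition_small _ _ F xip q y l rho (b - a) L c sigma) => //.
- move=> s t; rewrite !in_itv/= => /andP[s0 sb] /andP[t0 tb].
  rewrite [in leRHS]distrC (_ : t - s = (b - s) - (b - t)); last by ring.
  by apply: psiL; rewrite in_itv/=; apply/andP; split; lra.
- by rewrite /q subr0.
- move=> s; rewrite in_itv/= => /andP[s0 sb]; apply: psi_neq0.
  by rewrite in_itv/=; apply/andP; split; lra.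
- have := psi_nearp; rewrite nbhs_left0P; apply: filterS => s.
  by rewrite subKr.
- move=> x; have := wI (- x); rewrite !in_itv/= => /andP[? ?].
  by rewrite /y; apply/andP; split; lra.
- move=> x; rewrite /q /y subKr; have wdx := wd (- x).
  have wc : is_derive x (1 : R) (fun x => w (- x))
      (sigma^-1 * Num.sqrt (2 * F (psi (w (- x)))) * -1).
    exact: (@is_derive1_comp _ w -%R x _ _ wdx).
  apply: is_derive_eq (is_deriveB (is_derive_cst b x (1 : R)) wc) _.
  by rewrite sub0r mulrN1 opprK.
Qed.

Lemma transition_energy (g r A : R) : 0 < r ->
  A <= c / sigma * r * Num.sqrt (2 * l) ->
  exists eps0 C : R, [/\ 0 < eps0, 0 < C & forall eps, 0 < eps < eps0 ->
    forall u, (forall x, x \in `]g - r, g + r[ -> u x = transition_profile g r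
      eps x) ->
    (\int[lebesgue_measure]_(x in `[(g - r)%R, (g + r)%R]) energy_density F eps
      u x <=
      phi F a b xim xip + (C * expR (- (A / eps)))%:E)%E].
Proof.
move=> r0 Ar.
have [rhom [Mm [rhom0 Mm0 Fm]]] := xim_zero.
have [rhop [Mp [rhop0 Mp0 Fp]]] := xip_zero.
have [em [Cm [em0 Cm0 mP]]] := left_small r0 Ar rhom0 (fun h hr => (Fm h hr).1).
have [ep [Cp [ep0 Cp0 pP]]] := right_small r0 Ar rhop0 (fun h hr =>
  (Fp h hr).1).
(* The condition [eps < r] puts the breakpoints [g - r + eps] and [g + r - eps] in this order. *)
exists (Num.min r (Num.min em ep)), ((1 / 2 + Mm) * Cm + (1 / 2 + Mp) * Cp);
  split.
- by rewrite !lt_min r0 em0.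
- by rewrite addr_gt0// mulr_gt0// addr_gt0// divr_gt0.
move=> eps /andP[e0]; rewrite !lt_min => /and3P[er eem eep] u uE.
have [|qm qm2] := mP eps; first by rewrite e0.
have [|qp qp2] := pP eps; first by rewrite e0.
have [[M [_ _]] [psia psib] [_ psi_ae] -> [psi_neq0 _ _]] := psiP.
have [wI [dw cdw] wE _] := wP.
have Isplit (x y z : R) : x <= y -> y <= z -> `[x, z]%classic = `[x, y] `|`
  `[y, z].
  move=> xy yz; apply/seteqP; split => t /=; rewrite !in_itv/=.
    by move=> /andP[xt tz]; case: (leP t y) => ty; [left; rewrite xt|right;
      rewrite (ltW ty)].
  by move=> [|] /andP[? ?]; apply/andP; split; lra.
have Wd x : is_derive x (1 : R) (fun x => w ((x - g) / eps))
    (eps^-1 * (sigma^-1 * Num.sqrt (2 * F (psi (w ((x - g) / eps)))))).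
  have gx : is_derive x (1 : R) (fun x : R => eps^-1 *: (x - g)) eps^-1.
    apply: is_derive_eq (is_deriveZ _ (is_deriveB (is_derive_id x (1 : R))
      (is_derive_cst g x 1))) _.
    by rewrite subr0 scalerE mulr1.
  have Eg : (fun x : R => eps^-1 *: (x - g)) = (fun x => (x - g) / eps).
    by apply/funext => t; rewrite scalerE mulrC.
  rewrite mulrC; rewrite Eg in gx.
  exact: (@is_derive1_comp _ w (fun x =>
    (x - g) / eps) x _ _ (wd ((x - g) / eps)) gx).
rewrite (Isplit _ (g - r + eps)); [|lra|lra].
rewrite (Isplit (g - r + eps) (g + r - eps)); [|lra|lra].
have d0 x : (0 <= energy_density F eps u x)%E by exact: energy_density_ge0.
apply: le_trans (ge0_integral_setU_le _ _ _ _ _) _ => //.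
  exact: measurableU.
apply: (@le_trans _ _ (((1 / 2 + Mm) * (Cm * expR (- (A / eps))))%:E +
   (J F a b psi + ((1 / 2 + Mp) * (Cp * expR (- (A / eps))))%:E)))%E;
     last first.
  rewrite addeCA leeD2l// -EFinD lee_fin; lra.
apply: leeD.
  apply: (@le_trans _ _ (((1 / 2 + Mm) * enorm (psi (w (1 - r / eps)) - xim) ^+
    2)%:E)).
    apply: (@affine_piece_energy _ _ _ F_ge0 _ _ eps^-1 ((r - g) / eps) rhom _
      _ xim) => //.
    - exact: ltW.
    - by rewrite exprVn.
    - by move=> h /Fm[].
    move=> x; rewrite in_itv/= => /andP[x1 x2]; rewrite uE; last first.
      by rewrite in_itv/=; apply/andP; split; lra.
    have -> : eps^-1 * x + (r - g) / eps = (x - g + r) / eps by ring.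
    by rewrite /transition_profile x2; split => //;
      rewrite divr_ge0 ?ler_pdivrMr//=; lra.
  by rewrite lee_fin ler_wpM2l// addr_ge0 ?divr_ge0// ltW.
apply: le_trans (ge0_integral_setU_le _ _ _ _ _) _ => //.
apply: leeD.
  apply: (@transition_piece_energy _ _ F F_ge0 a b eps sigma psi (fun x =>
    w ((x - g) / eps))) => //.
  - have [L psiL] := psi_lip; apply: (@lipschitz_within_continuous _ _ _ _ L).
    by move=> s t; exact: psiL.
  - have -> : derive1 (fun x => w ((x - g) / eps)) = (fun x =>
    eps^-1 * derive1 w ((x - g) / eps)).
      by apply/funext => x; rewrite derive1E (@derive_val _ _ _ _ _ _ _ (Wd x))
        wE.
    move=> x; apply: cvgMr.
    apply: (@continuous_comp _ _ _ (fun x => (x - g) / eps)); last exact: cdw.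
    by apply: cvgMl; apply: cvgB; [exact: cvg_id|exact: cvg_cst].
  - by move=> x; rewrite derive1E (@derive_val _ _ _ _ _ _ _ (Wd x)) invfM
    mulrA.
  - lra.
  move=> x; rewrite in_itv/= => /andP[x1 x2]; rewrite uE; last first.
    by rewrite in_itv/=; apply/andP; split; lra.
  by rewrite /transition_profile ltNge (ltW x1) (ltW x2).
apply: (@le_trans _ _ (((1 / 2 + Mp) * enorm (psi (w (r / eps - 1)) - xip) ^+
  2)%:E)).
  (* The right endpoint is written as the left one plus [eps], the shape expected by
     [affine_piece_energy]; the slope is now negative. *)
  rewrite -[X in `[_, X]%classic](_ : g + r - eps + eps = _);
    last by rewrite subrK.
  apply: (@affine_piece_energy _ _ _ F_ge0 _ _ (- eps^-1) ((g + r) / eps) rhop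
    _ _ xip) => //.
  - exact: ltW.
  - by rewrite sqrrN exprVn.
  - by move=> h /Fp[].
  move=> x; rewrite in_itv/= => /andP[x1 x2]; rewrite uE; last first.
    by rewrite in_itv/=; apply/andP; split; lra.
  have -> : - eps^-1 * x + (g + r) / eps = (g + r - x) / eps by ring.
  rewrite /transition_profile ifF; last by apply/negbTE; rewrite -leNgt; lra.
  rewrite ifF; last by apply/negbTE; rewrite -ltNge.
  by split => //; rewrite divr_ge0 ?ler_pdivrMr//=; lra.
by rewrite lee_fin ler_wpM2l// addr_ge0 ?divr_ge0// ltW.
Qed.

End transition.

(** * The glued function *)

Lemma CkS (R : realType) (m k : nat) (F : 'rV[R]_m -> R) : Ck k.+1 F -> Ck k F.
Proof.
elim: k F => [|k IH] F [cF dF]; first by split.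
by split => // i; have [? ?] := dF i; split => //; exact: IH.
Qed.

Section step_function.
Context {R : realType} {m N : nat}.
Variables (F : 'rV[R]_m -> R) (a b : R) (gamma : 'I_N -> R) (r : R).
Variables (v : R -> 'rV[R]_m) (psi : 'I_N -> R -> 'rV[R]_m) (w : 'I_N -> R ->
  R).
Hypothesis r_gt0 : 0 < r.
Hypothesis v_step : step_with_jumps a b gamma v.

Lemma u0_transition eps i x :
  trivIset setT (fun i => [set` `]gamma i - r, gamma i + r[ ]) ->
  x \in `]gamma i - r, gamma i + r[ ->
  u0 gamma r v psi w eps x =
  transition_profile (v (gamma i - r)) (v (gamma i + r)) (psi i) (w i) (gamma
    i) r eps x.
Proof.
move=> disj xi; rewrite /u0; case: pickP => [j xj|/(_ i)]; last by rewrite xi.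
by rewrite (disj j i) //; exists x.
Qed.

(** The layers being closed, a whole neighbourhood of [x] avoids them; [v] cannot jump there, since
    every jump point lies in its own layer. *)
Lemma u0_near_cst eps x : x \in `]a, b[ ->
  (forall i, x \notin `[gamma i - r, gamma i + r]) ->
  \forall y \near x, u0 gamma r v psi w eps y = v x.
Proof.
move=> xab xI; have [_ _ v_cst _] := v_step.
have : \forall y \near x, (y \in `]a, b[) /\
    forall i, y \notin `[gamma i - r, gamma i + r].
  apply: filterI; first exact: near_in_itvoo.
  apply: (@filter_forall _ _ (fun i y => y \notin `[gamma i - r, gamma i + r])
    (nbhs x) (nbhs_filter x)) => i.
  have : open (~` `[gamma i - r, gamma i + r]%classic).
    by apply: closed_openC; exact: itv_closed.
  rewrite openE => /(_ x (negP (xI i))); rewrite /interior.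
  by apply: (@filterS _ (nbhs x) (nbhs_filter x)) => y /negP.
move=> /nbhs_normP[d /= d0 dP]; apply/nbhs_normP; exists d => // y /= xy.
have vE s t : `|x - s| < d -> `|x - t| < d -> s <= t -> v s = v t.
  move=> xs xt st; have [/[!in_itv]/= /andP[as_ _] _] := dP s xs.
  have [/[!in_itv]/= /andP[_ tb] _] := dP t xt.
  apply: v_cst => //; [exact: ltW|exact: ltW|move=> i;
    apply/negP => /[!in_itv]/= /andP[si it]].
  (* A jump point between [s] and [t] would be within [d] of [x], hence outside its own layer. *)
  have [_ /(_ i)] : (gamma i \in `]a, b[) /\ forall i0, gamma i \notin `[gamma
    i0 - r, gamma i0 + r].
    apply: dP => /=; move: xs xt; rewrite !ltr_norml => /andP[? ?] /andP[? ?].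
    by apply/andP; split; lra.
  by rewrite in_itv/= lerBlDr lerDl (ltW r_gt0).
have xx : `|x - x| < d by rewrite subrr normr0.
have vyx : v y = v x.
  by case: (leP x y) => [xy'|/ltW yx]; [apply/esym; exact: vE|exact: vE].
have [_ yI] := dP y xy; rewrite /u0; case: pickP => // i yi.
by have := yI i; rewrite (subset_itv_oo_cc yi).
Qed.

Lemma u0_energy_outside eps x : (forall y, y \in `[a, b] -> F (v y) = 0) ->
  x \in `]a, b[ -> (forall i, x \notin `[gamma i - r, gamma i + r]) ->
  energy_density F eps (u0 gamma r v psi w eps) x = 0%E.
Proof.
move=> Fv xab xI; have ux := u0_near_cst eps xab xI.
rewrite /energy_density (nbhs_singleton ux) Fv; last exact: subset_itv_oo_cc.
have -> : derive1 (u0 gamma r v psi w eps) x = 0.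
  rewrite derive1E (near_eq_derive _ (g := cst (v x))) ?derive_cst//.
by rewrite enorm0 expr0n mulr0 mul0r addr0.
Qed.

End step_function.

(** * The global energy estimate *)

Theorem proposition2 (R : realType) (m K N : nat) (a b : R)
    (F : 'rV[R]_m -> R) (z : 'I_K -> 'rV[R]_m)
    (v : R -> 'rV[R]_m) (gamma : 'I_N -> R) (r lambda c : R)
    (sigma : 'I_N -> R) (psi : 'I_N -> R -> 'rV[R]_m) (w : 'I_N -> R -> R)
    (m_ge1 : (1 <= m)%N) (K_ge2 : (2 <= K)%N) (ab : a < b)
    (F_C3 : Ck 3 F) (F_ge0 : forall x, 0 <= F x)
    (z_inj : injective z)
    (F_zeros : forall x, F x = 0 <-> exists j, x = z j)
    (F_hess : forall j, posdef (hessian F (z j)))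
    (lambdaP : minimum_of
       [set l | exists j, smallest_eigenvalue (hessian F (z j)) l] lambda)
    (v_values : forall x, x \in `[a, b] -> exists j, v x = z j)
    (v_step : step_with_jumps a b gamma v)
    (r_gt0 : 0 < r)
    (r_sub : forall i, `]gamma i - r, gamma i + r[ `<=` `[a, b])
    (r_disj : trivIset setT (fun i => [set` `]gamma i - r, gamma i + r[ ]))
    (c_gt0 : 0 < c)
    (psiP : forall i, optimal_path F a b c
       (v (gamma i - r)) (v (gamma i + r)) (sigma i) (psi i))
    (wP : forall i, profile F a b (sigma i) (psi i) (w i)) :
  forall A : R,
    0 < A < c * (\big[Num.max/0]_(i < N) sigma i)^-1 * r
              * Num.sqrt (2 * lambda) ->
  exists eps0 C : R, [/\ 0 < eps0, 0 < C &
    forall eps : R, 0 < eps < eps0 ->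
      (P_ F a b eps (u0 gamma r v psi w eps)
        <= P0 F a b gamma r v + (C * expR (- (A / eps)))%:E)%E].
Proof.
move=> A /andP[A0 Abound].
have [gamma_ab _ _ _] := v_step.
(* Read off from the range of [A]: [Num.sqrt] is 0 on nonpositive numbers, so [lambda <= 0] would
   leave no admissible [A]. *)
have la0 : 0 < lambda.
  rewrite ltNge; apply/negP => la0; have := lt_trans A0 Abound.
  by rewrite (ler0_sqrtr (_ : 2 * lambda <= 0)) ?mulr0 ?ltxx// pmulr_rle0.
have Fc : continuous F by case: F_C3.
have zq j : quadratic_zero F lambda (z j).
  have [HT _] := F_hess j.
  have [mu [muH muP]] := smallest_eigenvalue_rayleigh m_ge1 HT.
  apply: C2_zero_quadratic => //; first exact: CkS.
    by apply/F_zeros; exists j.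
  move=> x; apply: le_trans (muP x); rewrite ler_wpM2r ?sqr_ge0//.
  by apply: lambdaP.2; exists j.
(* Otherwise the midpoint of [gamma i - r] and [a] would lie in the open layer but outside
   [[a, b]]. *)
have gm i : a <= gamma i - r.
  have /[!in_itv]/= /andP[ag gb] := gamma_ab i.
  rewrite leNgt; apply/negP => ga.
  have /(_ ((gamma i - r + a) / 2)) := r_sub i; rewrite /= !in_itv/=.
  by move=> h; have /andP[] : a <= (gamma i - r + a) / 2 <= b;
    [apply: h; apply/andP; split; lra|lra].
have gp i : gamma i + r <= b.
  have /[!in_itv]/= /andP[ag gb] := gamma_ab i.
  rewrite leNgt; apply/negP => ga.
  have /(_ ((gamma i + r + b) / 2)) := r_sub i; rewrite /= !in_itv/=.
  by move=> h; have /andP[] : a <= (gamma i + r + b) / 2 <= b;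
    [apply: h; apply/andP; split; lra|lra].
have vq x : x \in `[a, b] -> quadratic_zero F lambda (v x).
  by move=> /v_values[j ->].
(* The largest [sigma i] gives the smallest rate, so the bound on [A] is valid for every layer. *)
have sigmaA i : A <= c / sigma i * r * Num.sqrt (2 * lambda).
  have [_ _ [si0 _] _ _] := psiP i.
  apply: le_trans (ltW Abound) _; rewrite ler_wpM2r ?sqrtr_ge0//.
  rewrite ler_wpM2r ?(ltW r_gt0)// ler_wpM2l ?(ltW c_gt0)//.
  have sle : sigma i <= \big[Num.max/0]_(j < N) sigma j by exact: le_bigmax.
  by rewrite lef_pV2 ?posrE// (lt_le_trans si0).
have /choice[e /choice[C eC]] : forall i, exists eps0 C : R,
  [/\ 0 < eps0, 0 < C & forall eps, 0 < eps < eps0 ->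
    (\int[lebesgue_measure]_(x in `[(gamma i - r)%R, (gamma i + r)%R])
      energy_density F eps (u0 gamma r v psi w eps) x <=
      phi F a b (v (gamma i - r)%R) (v (gamma i + r)%R) + (C * expR (- (A /
        eps)))%:E)%E].
  move=> i; have /[!in_itv]/= /andP[ag gb] := gamma_ab i.
  have gmI : gamma i - r \in `[a, b] by rewrite in_itv/= gm (le_trans _ (gp
    i))//; lra.
  have gpI : gamma i + r \in `[a, b] by rewrite in_itv/= gp (le_trans (gm
    i))//; lra.
  have [e [C [e0 C0 H]]] := transition_energy Fc F_ge0 la0 c_gt0 (vq _ gmI) (vq
    _ gpI)
    (psiP i) (wP i) (gamma i) r_gt0 (sigmaA i).
  exists e, C; split => // eps /H; apply => x xi; exact: u0_transition.
(* The default 1 of the minimum and the summand 1 give positive constants even for [N = 0]. *)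
exists (\big[Num.min/1]_i e i), (1 + \sum_i C i); split.
- by apply/bigmin_gtP; split => // i _; case: (eC i).
- by rewrite ltr_pwDl// sumr_ge0// => i _; case: (eC i) => _ /ltW.
move=> eps /andP[eps0 epse].
set u := u0 gamma r v psi w eps.
pose I i : set R := `[gamma i - r, gamma i + r]%classic.
pose U : set R := \big[setU/set0]_i I i.
have mI i : measurable (I i) by exact: measurable_itv.
have mU : measurable U by exact: bigsetU_measurable.
have d0 x : (0 <= energy_density F eps u x)%E by exact: energy_density_ge0.
have -> : P_ F a b eps u = (\int[lebesgue_measure]_(x in `[a, b])
  energy_density F eps u x)%E by [].
(* Closed layers may share endpoints, so the part inside [U] is bounded by subadditivity over the
   layers. *)
have -> : `[a, b]%classic = (`[a, b]%classic `\` U) `|` (`[a, b]%classic `&` U).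
  by rewrite setUC setUIDK.
apply: le_trans (ge0_integral_setU_le _ _ _ _ _) _ => //.
- exact: measurableD.
- exact: measurableI.
have out0 : (\int[lebesgue_measure]_(x in `[a, b] `\` U) energy_density F eps u
  x <= 0)%E.
  rewrite -[leRHS](@integral0 _ _ _ lebesgue_measure (`[a, b] `\` U)).
  apply: ge0_integral_ae_le => //; first exact: measurableD.
  (* The points [a] and [b] are discarded as a null set: the two-sided derivative there could see
     values of [v] outside [[a, b]]. *)
  suff : {ae @lebesgue_measure R, forall x, `[a, b]%classic x -> ~ U x ->
      (energy_density F eps u x <= 0)%E}.
    by apply: negligibleS => x /=; apply: contra_not => H [abx Ux]; exact: H.
  apply: ae_itvcc; apply: aeW => x xab Ux.
  rewrite (u0_energy_outside _ _ r_gt0 v_step)//.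
    by move=> y /v_values vy; apply/F_zeros.
  move=> i; apply/negP => xi; apply: Ux.
  by rewrite /U (bigD1 i)//=; left.
apply: le_trans (leeD out0 (lexx _)) _.
rewrite add0e; apply: (@le_trans _ _ (\sum_i (phi F a b (v (gamma i - r)%R) (v
  (gamma i + r)%R) + (C i * expR (- (A / eps)))%:E))%E).
  have /le_trans -> // : (\int[lebesgue_measure]_(x in `[a, b] `&` U)
    energy_density F eps u x <=
      \sum_i \int[lebesgue_measure]_(x in I i) energy_density F eps u x)%E.
    by apply: ge0_integral_sub_bigcup_le => //; exact: measurableI.
  apply: lee_sum => i _; have [_ _] := eC i; apply; rewrite eps0/=.
  by apply: lt_le_trans epse _; exact: bigmin_le.
rewrite big_split/= leeD2l// sumEFin lee_fin -mulr_suml ler_wpM2r ?expR_ge0//.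
by rewrite lerDr.
Qed.
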